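(* (a) For every irreducible component $\mathcal{C}\subset\mathcal{Y}$, there is a unique $K$-orbit $\mathfrak{O}_{\mathcal{C}}\subset\mathfrak{E}$ such that $\mathcal{C}\subset\overline{\pi^{-1}(\mathfrak{O}_{\mathcal{C}})}$. Moreover, the so-obtained map $\Xi:\mathrm{Irr}(\mathcal{Y})\to\mathfrak{E}/K$, $\mathcal{C}\mapsto\mathfrak{O}_{\mathcal{C}}$, is surjective, and each fiber of $\Xi$ contains at most two elements. (b) In the case where $p\leq\max\{k,n-k,q+1\}$, the map $\Xi$ is bijective.
   Context: Everything is over $\mathbb{C}$. Let $V=\mathbb{C}^n$ ($n\ge 1$), $p+q=n$, $V_1=\mathbb{C}^p\times\{0\}^q$, $V_2=\{0\}^p\times\mathbb{C}^q$, so $V=V_1\oplus V_2$. Let $G=\mathrm{GL}(V)$ and $K=\mathrm{GL}(V_1)\times\mathrm{GL}(V_2)\subset G$. Let $k\in\{0,\ldots,n\}$; $\mathrm{Gr}_k(V)$ is the Grassmann variety of $k$-dimensional subspaces of $V$ and $\mathbb{P}(V_1)$ is the variety of lines $L\subset V_1$. $\mathcal{L}(V)$ is the space of linear endomorphisms of $V$. For $x=\begin{pmatrix} x_1 & x_{12} \\ x_{21} & x_2 \end{pmatrix}\in\mathcal{L}(V)$ (blocks with respect to $V=V_1\oplus V_2$) put $x^{\theta}=\begin{pmatrix} x_1 & 0 \\ 0 & x_2 \end{pmatrix}$ and $x^{-\theta}=\begin{pmatrix} 0 & x_{12} \\ x_{21} & 0 \end{pmatrix}$. Let $\mathfrak{s}=\{x\in\mathcal{L}(V):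 x^\theta=0\}$. The conormal variety is $$\mathcal{Y}=\{(W,L,x)\in\mathrm{Gr}_k(V)\times\mathbb{P}(V_1)\times\mathcal{L}(V):\ \mathrm{Im}\,x\subset W\subset\ker x,\ \mathrm{Im}\,x^\theta\subset L\subset\ker x^\theta\},$$ and the exotic nilpotent cone is $\mathfrak{E}=\mathbb{P}(V_1)\times\mathcal{N}(\mathfrak{s})_2^k$, where $\mathcal{N}(\mathfrak{s})_2^k=\{x\in\mathfrak{s}: x^2=0,\ \mathrm{rk}\,x\le\min\{k,n-k\}\}$. The map $\pi:\mathcal{Y}\to\mathfrak{E}$, $(W,L,x)\mapsto(L,x^{-\theta})$, is well defined and surjective. $K$ acts on subspaces in the natural way and on $\mathcal{L}(V)$ by conjugation, hence diagonally on $\mathcal{Y}$ and $\mathfrak{E}$; $\pi$ is $K$-equivariant. $\mathfrak{E}/K$ is the set of $K$-orbits in $\mathfrak{E}$ (it is finite), $\mathrm{Irr}(\cdot)$ is the set of irreducible components, and $\overline{\pi^{-1}(\cdot)}$ is Zariski closure in $\mathcal{Y}$. *)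

(* Defs.v *)
From HB Require Import structures.
From mathcomp Require Import all_boot all_order all_algebra.
From mathcomp Require Import mpoly.
From mathcomp Require Import all_classical reals topology.
From mathcomp Require Import complex.

Set Implicit Arguments.
Unset Strict Implicit.
Unset Printing Implicit Defensive.

Import Order.TTheory GRing.Theory Num.Theory.

Local Open Scope classical_set_scope.
Local Open Scope ring_scope.
Local Open Scope complex_scope.

(* The complex numbers are R[i] with R : realType.  Vectors are columns, and a
   matrix acts on the left. *)

Definition mxlfun (R : realType) (m n : nat) (A : 'M[R[i]]_(m, n)) :
  'Hom('cV[R[i]]_n, 'cV[R[i]]_m) := linfun (mulmx A).

Definition imx (R : realType) (m n : nat) (A : 'M[R[i]]_(m, n)) :
  {vspace 'cV[R[i]]_m} := limg (mxlfun A).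

Definition kerx (R : realType) (m n : nat) (A : 'M[R[i]]_(m, n)) :
  {vspace 'cV[R[i]]_n} := lker (mxlfun A).

(* C^p x {0}^q *)
Definition V1 (R : realType) (p q : nat) : {vspace 'cV[R[i]]_(p + q)} :=
  imx (col_mx (1%:M : 'M[R[i]]_p) 0).

Definition Gr (R : realType) (k n : nat) : Type :=
  {W : {vspace 'cV[R[i]]_n} | \dim W == k}.

Definition PV1 (R : realType) (p q : nat) : Type :=
  {L : {vspace 'cV[R[i]]_(p + q)} | (\dim L == 1)%N && (L <= V1 R p q)%VS}.

(* Gr_k(V) x P(V_1) x L(V).  A definition of its own, so that the topology put
   on it below is the Zariski topology and not a product topology. *)
Definition GPL (R : realType) (p q k : nat) : Type :=
  (Gr R k (p + q) * PV1 R p q * 'M[R[i]]_(p + q))%type.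

HB.instance Definition _ R p q k := Choice.on (GPL R p q k).

Section GPLProjections.
Context {R : realType} {p q k : nat}.

Definition subW (t : GPL R p q k) : {vspace 'cV[R[i]]_(p + q)} := val t.1.1.
Definition lineL (t : GPL R p q k) : PV1 R p q := t.1.2.
Definition endx (t : GPL R p q k) : 'M[R[i]]_(p + q) := t.2.

End GPLProjections.

Section Zariski.
Context {R : realType} {p q k : nat}.
Local Notation C := (R[i]).
Local Notation n := (p + q)%N.
Local Notation N := (n * k + (n + n * n))%N.

(* The matrix A, whose columns form a basis of W, and the nonzero vector v of L
   are homogeneous coordinates for (W, L, x): Gr_k(V) is the quotient of the
   space of n x k matrices of rank k by GL_k, as P(V_1) is the quotient of
   V_1 \ {0} by GL_1. *)
Definition frame (A : 'M[C]_(n, k)) (v : 'cV[C]_n) (t : GPL R p q k) : Prop :=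
  imx A = subW t /\ <[v]>%VS = val (lineL t).

Definition coords (A : 'M[C]_(n, k)) (v : 'cV[C]_n) (x : 'M[C]_n)
    (i : 'I_N) : C :=
  row_mx (mxvec A) (row_mx v^T (mxvec x)) 0 i.

(* Quotient topology: a set is closed when its preimage in the space of
   triples (A, v, x) is the trace of the common zero locus of a set of
   polynomials in the entries of A, v and x.  The quotient map is a Zariski
   locally trivial bundle, so this is the Zariski topology of
   Gr_k(V) x P(V_1) x L(V). *)
Definition zclosed (Z : set (GPL R p q k)) : Prop :=
  exists S : set {mpoly C[N]},
    forall (t : GPL R p q k) (A : 'M[C]_(n, k)) (v : 'cV[C]_n),
      frame A v t ->
      (Z t <-> forall f, S f -> f.@[coords A v (endx t)] = 0).

Definition zopen : set_system (GPL R p q k) := [set U | zclosed (~` U)].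

Lemma zopenT : zopen setT.
Proof.
exists [set 1] => t A v _; split; first by move=> /(_ Logic.I).
by move=> /(_ 1 erefl) /eqP; rewrite meval1 oner_eq0.
Qed.

Lemma zopenI : setI_closed zopen.
Proof.
move=> U U' [S hS] [S' hS'].
exists [set h | exists f g, [/\ S f, S' g & h = f * g]] => t A v fr.
rewrite setCI; split.
  move=> Ut h [f [g [Sf Sg ->]]]; rewrite mevalM.
  case: Ut => [/(hS t A v fr) hf|/(hS' t A v fr) hg].
    by rewrite (hf f) ?mul0r.
  by rewrite (hg g) ?mulr0.
move=> h0; case: (pselect ((~` U) t)) => [|nU]; first by left.
right; apply/(hS' t A v fr) => g Sg; apply: contra_notP nU => /eqP gN0.
apply/(hS t A v fr) => f Sf; have := h0 _ (ex_intro _ f (ex_intro _ g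
  (And3 Sf Sg erefl))).
by rewrite mevalM => /eqP; rewrite mulf_eq0 (negPf gN0) orbF => /eqP.
Qed.

Lemma zopen_bigU (I : Type) (F : I -> set (GPL R p q k)) :
  (forall i, zopen (F i)) -> zopen (\bigcup_i F i).
Proof.
move=> /choice[S hS]; exists (\bigcup_i S i) => t A v fr.
rewrite setC_bigcup; split.
  by move=> Ft f [i _ Sf]; exact: (proj1 (hS i t A v fr) (Ft i Logic.I)).
by move=> h i _; apply/(hS i t A v fr) => f Sf; apply: h; exists i.
Qed.

HB.instance Definition _ :=
  isOpenTopological.Build (GPL R p q k) zopenT zopenI zopen_bigU.

Lemma closed_zclosed (Z : set (GPL R p q k)) : closed Z <-> zclosed Z.
Proof. by rewrite -openC -[X in _ <-> zclosed X]setCK. Qed.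

End Zariski.

Definition irreducible (T : topologicalType) (A : set T) : Prop :=
  A !=set0 /\
  forall F G : set T, closed F -> closed G ->
    A `<=` F `|` G -> A `<=` F \/ A `<=` G.

Definition Irr (T : topologicalType) (Y : set T) : set (set T) :=
  [set C | [/\ C `<=` Y, irreducible C &
     forall D, D `<=` Y -> irreducible D -> C `<=` D -> D = C]].

Section Exotic.
Context {R : realType} {p q : nat}.
Local Notation C := (R[i]).
Local Notation n := (p + q)%N.

Definition theta (x : 'M[C]_n) : 'M[C]_n :=
  block_mx (ulsubmx x) 0 0 (drsubmx x).

Definition mtheta (x : 'M[C]_n) : 'M[C]_n :=
  block_mx 0 (ursubmx x) (dlsubmx x) 0.

Definition conormal (k : nat) : set (GPL R p q k) :=
  [set t | [/\ (imx (endx t) <= subW t)%VS,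
               (subW t <= kerx (endx t))%VS,
               (imx (theta (endx t)) <= val (lineL t))%VS &
               (val (lineL t) <= kerx (theta (endx t)))%VS]].
Arguments conormal k t : clear implicits.

Definition frs : set 'M[C]_n := [set x | theta x = 0].

Definition nilcone2 (k : nat) : set 'M[C]_n :=
  [set x | [/\ frs x, x *m x = 0 & (\rank x <= minn k (n - k))%N]].

Definition exotic (k : nat) : set (PV1 R p q * 'M[C]_n) :=
  [set e | nilcone2 k e.2].

Definition pi_map (k : nat) (t : GPL R p q k) : PV1 R p q * 'M[C]_n :=
  (lineL t, mtheta (endx t)).

(* GL(V_1) x GL(V_2) *)
Definition groupK : set 'M[C]_n :=
  [set g | exists a : 'M[C]_p, exists b : 'M[C]_q,
     [/\ a \in unitmx, b \in unitmx & g = block_mx a 0 0 b]].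

Definition Korbit (e : PV1 R p q * 'M[C]_n) : set (PV1 R p q * 'M[C]_n) :=
  [set e' | exists2 g, groupK g &
     val e'.1 = (mxlfun g @: val e.1)%VS /\ e'.2 = g *m e.2 *m invmx g].

Definition exotic_orbits (k : nat) : set (set (PV1 R p q * 'M[C]_n)) :=
  Korbit @` exotic k.

Definition closure_preim (k : nat) (O : set (PV1 R p q * 'M[C]_n)) :
    set (GPL R p q k) :=
  conormal k `&` closure (conormal k `&` @pi_map k @^-1` O).
Arguments closure_preim k O _ : clear implicits.

(* The orbit O with D contained in the closure of pi^-1(O); a dummy value if
   there is none. *)
Definition Xi (k : nat) (D : set (GPL R p q k)) :
    set (PV1 R p q * 'M[C]_n) :=
  xget set0 [set O | exotic_orbits k O /\ D `<=` closure_preim k O].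

End Exotic.
Arguments conormal {R p q} k t.
Arguments closure_preim {R p q} k O t.

(* Main.v *)
(** The pairs (W, L) fall into finitely many K-orbits, indexed by
    a = dim W∩V1, b = dim W∩V2 and the position j of L with respect to the flag
    W∩V1 ⊂ (W+V2)∩V1 ⊂ V1, and Y is the union of the conormal bundles of these
    orbits.  Each bundle is irreducible, because any two of its points lie on a
    rational curve inside it, and none lies in the closure of another: this is
    read off from closed rank conditions evaluated at an explicit generic point,
    which replaces the usual dimension count.  So the components of Y are the
    closures of the bundles.  A K-orbit in the exotic cone is determined by
    rk x12, rk x21 and the position of L with respect to the flag
    Im x12 ⊂ Ker x21 ⊂ V1, and the generic value of this datum on a bundle is
    given by explicit formulas in (a, b, j).  Inverting them shows that every
    orbit is attained, by one bundle, or by two when q < k < p,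
    rk x12 + rk x21 = q and L ⊂ Ker x21 is not contained in Im x12. *)
Require Import Defs.
From mathcomp Require Import all_boot all_order all_algebra.
From mathcomp Require Import mpoly.
From mathcomp Require Import all_classical reals topology.
From mathcomp Require Import complex.
From mathcomp Require Import zify.

Set Implicit Arguments.
Unset Strict Implicit.
Unset Printing Implicit Defensive.

Import Order.TTheory GRing.Theory Num.Theory.

Local Open Scope classical_set_scope.
Local Open Scope ring_scope.
Local Open Scope complex_scope.

(** * Column spaces *)

Section ColumnSpaces.
Context {F : fieldType}.

(** What separates the bundles is a pair of opposite monotonicities. If the bundle of type (a, b, j)
    lies in the closure of that of type (a', b', j'), the dimensions of W∩V1 and W∩V2 can only jump
    up, so a' <= a and b' <= b; but the generic ranks of x12 and x21 increase with a and b and can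
    only drop in the closure, so a <= a' and b <= b' up to an error of one. The error has two
    sources. The condition x W = 0 reads [X *m A2 = - (v *m phi *m A1)], a matrix of rank at most
    one that can be nonzero only for j = 0. The condition Im x < W makes a single matrix [y1]
    produce both [v *m phi = A1 *m y1] and [Y = A2 *m y1], which leaves room for one more unit in
    the rank of [Y] when j = 1. These are the corrections in [gen_r] and [gen_s]. Further ranks,
    involving L and the block x1, settle the cases where such a unit intervenes. *)

Lemma rank_row_mxP m n1 n2 (A : 'M[F]_(m, n1)) (B : 'M[F]_(m, n2)) :
  reflect (exists u, B = A *m u) (\rank (row_mx A B) <= \rank A)%N.
Proof.
rewrite -mxrank_tr tr_row_mx -addsmxE -(mxrank_tr A).
apply: (iffP idP) => [le|[u ->]].
  have : (A^T + B^T <= A^T)%MS.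
    by rewrite -(mxrank_leqif_sup (addsmxSl _ _)) eqn_leq le mxrankS ?addsmxSl.
  rewrite addsmx_sub => /andP[_ /submxP[D /(congr1 trmx)]].
  by rewrite trmxK trmx_mul trmxK => ->; exists D^T.
by apply: mxrankS; rewrite addsmx_sub submx_refl trmx_mul submxMl.
Qed.

Lemma rank_row_mx_notin m n (A : 'M[F]_(m, n)) (v : 'cV[F]_m) :
  ~ (exists u, v = A *m u) -> \rank (row_mx A v) = (\rank A).+1.
Proof.
move=> nv; apply/eqP; rewrite eqn_leq; apply/andP; split; last first.
  by rewrite ltnNge; apply/negP => /rank_row_mxP.
rewrite -mxrank_tr tr_row_mx -addsmxE (leq_trans (mxrank_adds_leqif _ _)) //.
by rewrite -[X in (_ <= X)%N]addn1 mxrank_tr leq_add2l rank_leq_row.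
Qed.

Lemma rank_row_mxC m n1 n2 (A : 'M[F]_(m, n1)) (B : 'M[F]_(m, n2)) :
  \rank (row_mx A B) = \rank (row_mx B A).
Proof.
by rewrite -mxrank_tr -[RHS]mxrank_tr !tr_row_mx -!addsmxE addsmxC.
Qed.

Lemma rank_col_mxC m1 m2 n (A : 'M[F]_(m1, n)) (B : 'M[F]_(m2, n)) :
  \rank (col_mx A B) = \rank (col_mx B A).
Proof. by rewrite -!addsmxE addsmxC. Qed.

Lemma rank_row_mxA m n1 n2 n3 (A : 'M[F]_(m, n1)) (B : 'M[F]_(m, n2))
    (C : 'M[F]_(m, n3)) :
  \rank (row_mx A (row_mx B C)) = \rank (row_mx (row_mx A B) C).
Proof.
by rewrite -mxrank_tr -[RHS]mxrank_tr !tr_row_mx col_mxA eqmx_cast.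
Qed.

Lemma full_rank_inverse m n (A : 'M[F]_(m, n)) :
  \rank A = m -> m = n ->
  exists2 B : 'M[F]_(n, m), A *m B = 1%:M & B *m A = 1%:M.
Proof.
move=> rA mn; have fA : row_free A by rewrite /row_free rA.
have uA : row_full A by rewrite /row_full rA mn.
exists (pinvmx A); [exact: mulmxVp | exact: mulVpmx].
Qed.

Lemma full_rank_left_inverse m n (A : 'M[F]_(m, n)) : \rank A = n ->
  exists B : 'M[F]_(n, m), B *m A = 1%:M.
Proof. by move=> rA; apply/row_fullP; rewrite /row_full rA. Qed.

(* The first basis vector; it is 0 if d = 0. *)
Definition e0 d : 'cV[F]_d := pid_mx 1.

Lemma complete_cols m n d (U : 'M[F]_(m, n)) : (\rank U + d)%N = m ->
  exists P : 'M[F]_(m, d), \rank (row_mx U P) = m.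
Proof.
move=> rU; have rC : \rank (U^T^C)%MS = d.
  by rewrite mxrank_compl mxrank_tr; lia.
(* [row_base] has as many rows as the rank, so [d] is replaced by that rank. *)
case: _ / rC {rU}; exists (row_base (U^T)^C)%MS^T.
rewrite -mxrank_tr tr_row_mx trmxK -addsmxE.
rewrite (adds_eqmx (eqmx_refl _) (eq_row_base _)).
exact/eqP/addsmx_compl_full.
Qed.

(** Making v the first new column lets a basis adapted to W carry the line L along. *)
Lemma complete_cols_through m n d (U : 'M[F]_(m, n)) (v : 'cV[F]_m) :
  (\rank U + d)%N = m -> ~ (exists u, v = U *m u) ->
  exists2 P : 'M[F]_(m, d), \rank (row_mx U P) = m & v = P *m e0 d.
Proof.
move=> rU nv; have rUv := rank_row_mx_notin nv.
have le := rank_leq_row (row_mx U v).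
case: d rU => [|d] rU; first by exfalso; lia.
have [|P rP] := @complete_cols m _ d (row_mx U v); first by lia.
exists (row_mx v P : 'M_(m, 1 + d)); first exact: etrans (rank_row_mxA _ _ _) rP.
rewrite /e0 -[d.+1]/(1 + d)%N pid_mx_col.
by rewrite (@mul_row_col _ m 1 d 1) mulmx1 mulmx0 addr0.
Qed.

Lemma kernel_basis m n d (A : 'M[F]_(m, n)) : (\rank A + d)%N = n ->
  exists K : 'M[F]_(n, d), [/\ A *m K = 0, \rank K = d &
    forall l (Z : 'M[F]_(n, l)), A *m Z = 0 -> exists W, Z = K *m W].
Proof.
move=> rA; have rK : \rank (kermx A^T) = d.
  by rewrite mxrank_ker mxrank_tr; lia.
case: _ / rK {rA}; exists (row_base (kermx A^T))^T; split.
- apply: trmx_inj; rewrite trmx_mul trmxK trmx0; apply/sub_kermxP.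
  by rewrite eq_row_base.
- by rewrite mxrank_tr; apply/eqP; exact: row_base_free.
- move=> l Z /(congr1 trmx); rewrite trmx_mul trmx0 => /sub_kermxP.
  have le : (kermx A^T <= row_base (kermx A^T))%MS by rewrite eq_row_base.
  move/submx_trans => /(_ _ _ le) /submxP[D /(congr1 trmx)].
  by rewrite trmxK trmx_mul => ->; exists D^T.
Qed.

Lemma kernel_basis_through m n d (A : 'M[F]_(m, n)) (v : 'cV[F]_n) :
  (\rank A + d)%N = n -> A *m v = 0 -> v != 0 ->
  exists K : 'M[F]_(n, d), [/\ A *m K = 0, \rank K = d &
    v = K *m e0 d].
Proof.
move=> rA Av v0; have [K [AK rK Kw]] := kernel_basis rA.
have [w vw] := Kw _ v Av.
have [] := @complete_cols_through d 0 d 0 w; first by rewrite mxrank0.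
  by case=> u wu; move: v0; rewrite vw wu mul0mx mulmx0 eqxx.
move=> P; rewrite rank_row_0mx => rP wP; exists (K *m P); split.
- by rewrite mulmxA AK mul0mx.
- by rewrite mxrankMfree // /row_free rP.
- by rewrite -mulmxA -wP.
Qed.

End ColumnSpaces.

(** * Normal form of a pair (W, L) *)

Section Pairs.
Context {F : fieldType}.

Lemma mulmx_free0 m n l (A : 'M[F]_(m, n)) (Z : 'M[F]_(n, l)) :
  \rank A = n -> A *m Z = 0 -> Z = 0.
Proof. by case/full_rank_left_inverse => B BA AZ; rewrite -[Z]mul1mx -BA -mulmxA AZ mulmx0. Qed.

Lemma rank_col_inj m n (A : 'M[F]_(m, n)) :
  (forall z : 'cV[F]_n, A *m z = 0 -> z = 0) -> \rank A = n.
Proof.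
move=> injA; have le := rank_leq_col A.
have [|K [AK rK _]] := @kernel_basis _ _ _ (n - \rank A)%N A; first by lia.
suff K0 : K = 0 by move: rK; rewrite K0 mxrank0; lia.
apply/matrixP => i j; have /injA : A *m col j K = 0 by rewrite colE mulmxA AK mul0mx.
by move/matrixP/(_ i 0); rewrite !mxE.
Qed.

(** The columns of [K1] and [K2] are coordinates of vectors of W∩V1 and W∩V2, and V1∩V2 = 0. *)
Lemma rank_kernels p q k a b (A1 : 'M[F]_(p, k)) (A2 : 'M[F]_(q, k))
    (K1 : 'M[F]_(k, a)) (K2 : 'M[F]_(k, b)) :
  \rank (col_mx A1 A2) = k -> A2 *m K1 = 0 -> A1 *m K2 = 0 ->
  \rank K1 = a -> \rank K2 = b -> \rank (row_mx K1 K2) = (a + b)%N.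
Proof.
move=> rA AK1 AK2 rK1 rK2.
apply: rank_col_inj => z; rewrite -[z]vsubmxK mul_row_col.
move: (usubmx z) (dsubmx z) => z1 z2 /eqP; rewrite addr_eq0 => /eqP zE.
have z10 : K1 *m z1 = 0.
  apply: (mulmx_free0 rA); rewrite mul_col_mx (mulmxA A2) AK1 mul0mx zE.
  by rewrite mulmxN mulmxA AK2 mul0mx oppr0 col_mx0.
rewrite (mulmx_free0 rK1 z10); move/eqP: zE.
by rewrite z10 eq_sym oppr_eq0 => /eqP/(mulmx_free0 rK2) ->; rewrite col_mx0.
Qed.

(* W is the column space of col_mx A1 A2 and L is spanned by v in V1; the cases
   are L < W, L < W + V2 but not in W, and L not in W + V2. *)
Definition line_pos p q k (j : nat) (A1 : 'M[F]_(p, k)) (A2 : 'M[F]_(q, k))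
    (v : 'cV[F]_p) : Prop :=
  match j with
  | 0 => exists u, v = A1 *m u /\ A2 *m u = 0
  | 1 => (exists u, v = A1 *m u) /\ ~ (exists u, v = A1 *m u /\ A2 *m u = 0)
  | _ => ~ (exists u, v = A1 *m u)
  end.

(** The numbers are crossed because, on W, the kernel of [A1] is W∩V2 and the kernel of [A2] is
    W∩V1. *)
Definition pair_type p q k a b j (A1 : 'M[F]_(p, k)) (A2 : 'M[F]_(q, k))
    (v : 'cV[F]_p) : Prop :=
  [/\ (\rank A1 + b)%N = k, (\rank A2 + a)%N = k, \rank (col_mx A1 A2) = k,
      v != 0 & line_pos j A1 A2 v].

Lemma pair_type_leq p q k a b j (A1 : 'M[F]_(p, k)) (A2 : 'M[F]_(q, k))
    (v : 'cV[F]_p) : pair_type a b j A1 A2 v -> (a + b <= k)%N.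
Proof.
case=> rA1 rA2 rA _ _.
have [K1 [AK1 rK1 _]] := kernel_basis rA2.
have [K2 [AK2 rK2 _]] := kernel_basis rA1.
by rewrite -(rank_kernels rA AK1 AK2 rK1 rK2) rank_leq_row.
Qed.

(* E1, E2, E3 are the coordinates in W of bases of W∩V1, of W∩V2, and of a
   complement of their sum. *)
Lemma pair_type_basis p q k a b c d e j (A1 : 'M[F]_(p, k)) (A2 : 'M[F]_(q, k))
    (v : 'cV[F]_p) :
  pair_type a b j A1 A2 v ->
  (a + b + c = k)%N -> (a + c + d = p)%N -> (b + c + e = q)%N ->
  exists (E1 : 'M[F]_(k, a)) (E2 : 'M[F]_(k, b)) (E3 : 'M[F]_(k, c))
    (P : 'M[F]_(p, d)) (Q : 'M[F]_(q, e)),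
  [/\ A1 *m E2 = 0 /\ A2 *m E1 = 0,
      \rank (row_mx (row_mx E1 E2) E3) = k,
      \rank (row_mx (row_mx (A1 *m E1) (A1 *m E3)) P) = p,
      \rank (row_mx (row_mx (A2 *m E2) (A2 *m E3)) Q) = q &
      v = match j with 0 => A1 *m E1 *m e0 a | 1 => A1 *m E3 *m e0 c
          | _ => P *m e0 d end].
Proof.
move=> [rA1 rA2 rA v0 jv] kE pE qE.
have [E1 [A2E1 rE1 vE1]] : exists E1 : 'M[F]_(k, a),
    [/\ A2 *m E1 = 0, \rank E1 = a & j = 0%N -> v = A1 *m E1 *m e0 a].
  case: j jv => [[u [vu Au]]|j _]; last first.
    by have [E [AE rE _]] := kernel_basis rA2; exists E.
  have u0 : u != 0 by apply: contra v0; rewrite vu => /eqP->; rewrite mulmx0.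
  have [E [AE rE uE]] := kernel_basis_through rA2 Au u0.
  by exists E; split => // _; rewrite -mulmxA -uE.
have [E2 [A1E2 rE2 _]] := kernel_basis rA1.
have rE12 : \rank (row_mx E1 E2) = (a + b)%N.
  exact: rank_kernels rA _ _ _ _.
have rE12c : (\rank (row_mx E1 E2) + c)%N = k by rewrite rE12.
have [E3 [rE vE3]] : exists E3 : 'M[F]_(k, c),
    \rank (row_mx (row_mx E1 E2) E3) = k /\ (j = 1%N -> v = A1 *m E3 *m e0 c).
  case: j jv {vE1} => [_|[[[u vu] nv]|j _]].
  - by have [E rE] := complete_cols rE12c; exists E.
  - have [|E rE uE] := complete_cols_through (v := u) rE12c; last first.
      by exists E; split => // _; rewrite -mulmxA -uE.
    (* If u were a combination of [E1] and [E2], then, [A1] killing [E2], the line would already lie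
       in W∩V1. *)
    case=> w uw; apply: nv; exists (E1 *m usubmx w).
    rewrite (mulmxA A2) A2E1 mul0mx; split=> //.
    rewrite vu uw -[w in LHS]vsubmxK mul_row_col mulmxDr.
    by rewrite [A1 *m (E2 *m _)]mulmxA A1E2 mul0mx addr0.
  - by have [E rE] := complete_cols rE12c; exists E.
have [E' EE' _] := full_rank_inverse rE (esym kE).
have fE : row_free (row_mx (row_mx E1 E2) E3) by apply/row_freeP; exists E'.
have rP : (\rank (row_mx (A1 *m E1) (A1 *m E3)) + d)%N = p.
  suff -> : \rank (row_mx (A1 *m E1) (A1 *m E3)) = \rank A1 by lia.
  rewrite -(mxrankMfree A1 fE) !mul_mx_row A1E2.
  by rewrite rank_row_mxC [RHS]rank_row_mxC rank_row_mxA rank_row_mx0.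
have rQ : (\rank (row_mx (A2 *m E2) (A2 *m E3)) + e)%N = q.
  suff -> : \rank (row_mx (A2 *m E2) (A2 *m E3)) = \rank A2 by lia.
  by rewrite -(mxrankMfree A2 fE) !mul_mx_row A2E1 -rank_row_mxA rank_row_0mx.
have [Q rQ'] := complete_cols rQ.
have [P [rP' vP]] : exists P : 'M[F]_(p, d),
    \rank (row_mx (row_mx (A1 *m E1) (A1 *m E3)) P) = p /\
    ((1 < j)%N -> v = P *m e0 d).
  case: j jv {vE1 vE3} => [_|[_|j nv]].
  - by have [P rP'] := complete_cols rP; exists P.
  - by have [P rP'] := complete_cols rP; exists P.
  - have [|P rP' vP] := complete_cols_through (v := v) rP; last by exists P.
    case=> w vw; apply: nv; exists (row_mx E1 E3 *m w).
    by rewrite mulmxA mul_mx_row.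
exists E1, E2, E3, P, Q; split=> //.
by case: j {jv} vE1 vE3 vP => [->|[_ ->|j _ _ ->]].
Qed.

(** Both pairs have bases of V1 and V2 adapted to W and L with blocks of the same sizes; g1 and g2
    match these bases, and h is the induced change of basis of W. *)
Lemma pair_type_transitive p q k a b j (A1 B1 : 'M[F]_(p, k))
    (A2 B2 : 'M[F]_(q, k)) (v w : 'cV[F]_p) :
  pair_type a b j A1 A2 v -> pair_type a b j B1 B2 w ->
  exists g1 g2 h, [/\ [/\ g1 \in unitmx, g2 \in unitmx & h \in unitmx],
    g1 *m A1 = B1 *m h, g2 *m A2 = B2 *m h & g1 *m v = w].
Proof.
move=> tA tB; have abk := pair_type_leq tA; case: (tA) => rA1 rA2 _ _ _.
have kE : (a + b + (k - a - b) = k)%N by lia.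
have pE : (a + (k - a - b) + (p - (k - b)) = p)%N.
  by have := rank_leq_row A1; lia.
have qE : (b + (k - a - b) + (q - (k - a)) = q)%N.
  by have := rank_leq_row A2; lia.
move: (k - a - b)%N (p - _)%N (q - _)%N kE pE qE => c d e kE pE qE.
have [E1 [E2 [E3 [P [Q [[A1E2 A2E1] rE rP rQ vE]]]]]] :=
  pair_type_basis tA kE pE qE.
have [G1 [G2 [G3 [S [T [[B1G2 B2G1] rG rS rT wE]]]]]] :=
  pair_type_basis tB kE pE qE.
have [E' EE' E'E] := full_rank_inverse rE (esym kE).
have [P' PP' P'P] := full_rank_inverse rP (esym pE).
have [Q' QQ' Q'Q] := full_rank_inverse rQ (esym qE).
have [G' GG' G'G] := full_rank_inverse rG (esym kE).
have [S' SS' S'S] := full_rank_inverse rS (esym pE).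
have [T' TT' T'T] := full_rank_inverse rT (esym qE).
set g1 := row_mx (row_mx (B1 *m G1) (B1 *m G3)) S *m P'.
set g2 := row_mx (row_mx (B2 *m G2) (B2 *m G3)) T *m Q'.
set h := row_mx (row_mx G1 G2) G3 *m E'.
have g1P : g1 *m row_mx (row_mx (A1 *m E1) (A1 *m E3)) P =
    row_mx (row_mx (B1 *m G1) (B1 *m G3)) S by rewrite -mulmxA P'P mulmx1.
have g2Q : g2 *m row_mx (row_mx (A2 *m E2) (A2 *m E3)) Q =
    row_mx (row_mx (B2 *m G2) (B2 *m G3)) T by rewrite -mulmxA Q'Q mulmx1.
move: (g1P) (g2Q); rewrite !mul_mx_row.
move/eq_row_mx=> [/eq_row_mx[g1E1 g1E3] g1E].
move/eq_row_mx=> [/eq_row_mx[g2E2 g2E3] g2E].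
exists g1, g2, h; split.
- split; rewrite -row_free_unit; apply/row_freeP.
  + exists (row_mx (row_mx (A1 *m E1) (A1 *m E3)) P *m S').
    by rewrite mulmxA g1P.
  + exists (row_mx (row_mx (A2 *m E2) (A2 *m E3)) Q *m T').
    by rewrite mulmxA g2Q.
  + exists (row_mx (row_mx E1 E2) E3 *m G').
    by rewrite mulmxA -(mulmxA _ E') E'E mulmx1.
- rewrite -[LHS]mulmx1 -EE' mulmxA -mulmxA mulmxA [RHS]mulmxA; congr (_ *m _).
  rewrite -mulmxA !mul_mx_row A1E2 B1G2 mulmx0.
  by rewrite g1E1 g1E3.
- rewrite -[LHS]mulmx1 -EE' mulmxA [RHS]mulmxA; congr (_ *m _).
  rewrite -mulmxA !mul_mx_row A2E1 B2G1 mulmx0.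
  by rewrite g2E2 g2E3.
- rewrite vE wE; case: (j) => [|[|_]]; rewrite !mulmxA.
  + by rewrite -(mulmxA g1) g1E1.
  + by rewrite -(mulmxA g1) g1E3.
  + by rewrite g1E.
Qed.

End Pairs.

(** * Normal form of a point of the exotic cone *)

Section NilpotentPairs.
Context {F : fieldType}.

Lemma lift_image_basis_rank m n s (Y : 'M[F]_(m, n)) (K : 'M[F]_(n, n - s))
    (E : 'M[F]_(n, s)) :
  (s <= n)%N -> Y *m K = 0 -> \rank (row_mx K E) = n ->
  \rank (Y *m E) = \rank Y.
Proof.
move=> le YK rKE; have fKE : row_free (row_mx K E) by rewrite /row_free rKE.
by rewrite -(mxrankMfree Y fKE) mul_mx_row YK rank_row_0mx.
Qed.

Lemma lift_image_basis m n s (Y : 'M[F]_(m, n)) : \rank Y = s ->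
  exists E : 'M[F]_(n, s), \rank (Y *m E) = s.
Proof.
move=> rY; have le : (s <= n)%N by rewrite -rY rank_leq_col.
have [|K [YK rK _]] := @kernel_basis _ _ _ (n - s)%N Y; first by lia.
have [|E rKE] := @complete_cols _ _ _ s K; first by lia.
by exists E; rewrite (lift_image_basis_rank le YK rKE).
Qed.

Lemma lift_image_basis_through m n s (Y : 'M[F]_(m, n)) (v : 'cV[F]_n) :
  \rank Y = s -> Y *m v != 0 ->
  exists2 E : 'M[F]_(n, s), \rank (Y *m E) = s & v = E *m e0 s.
Proof.
move=> rY Yv; have le : (s <= n)%N by rewrite -rY rank_leq_col.
have [|K [YK rK _]] := @kernel_basis _ _ _ (n - s)%N Y; first by lia.
have [||E rKE vE] := @complete_cols_through _ _ _ s K v; first by lia.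
  by case=> u vu; move: Yv; rewrite vu mulmxA YK mul0mx eqxx.
by exists E => //; rewrite (lift_image_basis_rank le YK rKE).
Qed.

(** [M] completes [U] to a basis of Ker Y, and [E], which Y maps to independent vectors, spans a
    complement of Ker Y. The flag [through] asks in addition that v be the first column of [M]. *)
Lemma complete_flag n (through : bool) l r t s (Y : 'M[F]_(l, n)) (U : 'M[F]_(n, r))
    (E : 'M[F]_(n, s)) (v : 'cV[F]_n) :
  Y *m U = 0 -> \rank U = r -> \rank Y = s -> \rank (Y *m E) = s ->
  (r + t + s = n)%N ->
  (through -> Y *m v = 0 /\ ~ (exists u, v = U *m u)) ->
  exists M : 'M[F]_(n, t), [/\ Y *m M = 0,
    \rank (row_mx (row_mx U M) E) = n & through -> v = M *m e0 t].
Proof.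
move=> YU rU rY rYE nE hv.
have [|K [YK rK KP]] := @kernel_basis _ _ _ (r + t)%N Y; first by lia.
have [Z UZ] := KP _ _ YU.
have fK : row_full K by rewrite /row_full rK.
have rZ : (\rank Z + t)%N = (r + t)%N.
  by rewrite -(eqmxMfull Z fK) -UZ rU.
suff [M0 rM0 vM0] : exists2 M0 : 'M[F]_(r + t, t),
    \rank (row_mx Z M0) = (r + t)%N & through -> v = K *m M0 *m e0 t.
  exists (K *m M0); split => //; first by rewrite mulmxA YK mul0mx.
  rewrite -[RHS]nE UZ -mul_mx_row; apply: rank_col_inj => z.
  rewrite -[z]vsubmxK mul_row_col; move: (usubmx z) (dsubmx z) => z1 z2 z0.
  have z20 : z2 = 0.
    apply: (mulmx_free0 rYE).
    by have := congr1 (mulmx Y) z0; rewrite mulmxDr !mulmxA YK !mul0mx add0r mulmx0.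
  move: z0; rewrite z20 mulmx0 addr0 -mulmxA => /(mulmx_free0 rK).
  by move/(mulmx_free0 rM0) ->; rewrite col_mx0.
case: through hv => [/(_ isT)[Yv nv]|_]; last first.
  by have [M0 rM0] := complete_cols rZ; exists M0.
have [w vw] := KP _ _ Yv.
have [|M0 rM0 wM0] := complete_cols_through (v := w) rZ.
  by case=> u wu; apply: nv; exists u; rewrite vw wu UZ mulmxA.
by exists M0 => // _; rewrite -mulmxA -wM0.
Qed.

(* L < Im X, L < Ker Y but not in Im X, and L not in Ker Y; here
   x = block_mx 0 X Y 0. *)
Definition nil_pos p q (j : nat) (X : 'M[F]_(p, q)) (Y : 'M[F]_(q, p))
    (v : 'cV[F]_p) : Prop :=
  match j with
  | 0 => exists f, v = X *m f
  | 1 => Y *m v = 0 /\ ~ (exists f, v = X *m f)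
  | _ => Y *m v <> 0
  end.

Definition nil_type p q r s j (X : 'M[F]_(p, q)) (Y : 'M[F]_(q, p))
    (v : 'cV[F]_p) : Prop :=
  [/\ X *m Y = 0 /\ Y *m X = 0, \rank X = r, \rank Y = s, v != 0 &
      nil_pos j X Y v].

(** This is a Jordan basis of x, where x^2 = 0: the chains G -> X G and E -> Y E have length two,
    and [M], [M'] complete the kernel. The position of L decides in which block of V1 its generator
    is the first column. *)
Lemma nil_type_basis p q r s t t' j (X : 'M[F]_(p, q)) (Y : 'M[F]_(q, p))
    (v : 'cV[F]_p) :
  nil_type r s j X Y v -> (r + t + s = p)%N -> (s + t' + r = q)%N ->
  exists (G : 'M[F]_(q, r)) (M : 'M[F]_(p, t)) (E : 'M[F]_(p, s))
    (M' : 'M[F]_(q, t')),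
  [/\ Y *m M = 0 /\ X *m M' = 0,
      \rank (row_mx (row_mx (X *m G) M) E) = p,
      \rank (row_mx (row_mx (Y *m E) M') G) = q &
      v = match j with 0 => X *m G *m e0 r | 1 => M *m e0 t
          | _ => E *m e0 s end].
Proof.
move=> [[XY YX] rX rY v0 jv] pE qE.
have [E [rYE vE]] : exists E : 'M[F]_(p, s),
    \rank (Y *m E) = s /\ ((1 < j)%N -> v = E *m e0 s).
  case: j jv => [_|[_|j /eqP Yv]].
  - by have [E rE] := lift_image_basis rY; exists E.
  - by have [E rE] := lift_image_basis rY; exists E.
  - by have [E rE vE] := lift_image_basis_through rY Yv; exists E.
have [G [rXG vG]] : exists G : 'M[F]_(q, r),
    \rank (X *m G) = r /\ (j = 0%N -> v = X *m G *m e0 r).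
  case: j jv {vE} => [[f vf]|j _].
  - have Xf : X *m f != 0 by rewrite -vf.
    have [G rG fG] := lift_image_basis_through rX Xf.
    by exists G; split=> // _; rewrite -mulmxA -fG.
  - by have [G rG] := lift_image_basis rX; exists G.
have YXG : Y *m (X *m G) = 0 by rewrite mulmxA YX mul0mx.
have XYE : X *m (Y *m E) = 0 by rewrite mulmxA XY mul0mx.
have [|M [YM rM vM]] := complete_flag (through := j == 1) (v := v) YXG rXG rY rYE pE.
  move=> /eqP j1; move: jv; rewrite j1 /= => -[Yv nv]; split=> // -[u vu].
  by apply: nv; exists (G *m u); rewrite mulmxA.
have [//|M' [XM' rM' _]] :=
  complete_flag (through := false) (v := 0) XYE rYE rX rXG qE.
exists G, M, E, M'; split=> //.
by case: j {jv} vE vG vM => [_ -> //|[_ _ -> //|j -> //]].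
Qed.

Lemma nil_type_transitive p q r s j (X X' : 'M[F]_(p, q))
    (Y Y' : 'M[F]_(q, p)) (v w : 'cV[F]_p) :
  nil_type r s j X Y v -> nil_type r s j X' Y' w ->
  exists g1 g2, [/\ g1 \in unitmx /\ g2 \in unitmx,
    g1 *m X = X' *m g2, g2 *m Y = Y' *m g1 & g1 *m v = w].
Proof.
move=> tX tX'; case: (tX) => -[XY YX] rX rY _ _.
have pE : (r + (p - r - s) + s = p)%N by have := mulmx0_rank_max YX; lia.
have qE : (s + (q - r - s) + r = q)%N by have := mulmx0_rank_max XY; lia.
move: (p - _ - _)%N (q - _ - _)%N pE qE => t t' pE qE.
have [G [M [E [N [[YM XN] rP rQ vE]]]]] := nil_type_basis tX pE qE.
have [G' [M' [E' [N' [[YM' XN'] rP' rQ' wE]]]]] := nil_type_basis tX' pE qE.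
have [P PP' P'P] := full_rank_inverse rP (esym pE).
have [Q QQ' Q'Q] := full_rank_inverse rQ (esym qE).
have [S SS' S'S] := full_rank_inverse rP' (esym pE).
have [T TT' T'T] := full_rank_inverse rQ' (esym qE).
set g1 := row_mx (row_mx (X' *m G') M') E' *m P.
set g2 := row_mx (row_mx (Y' *m E') N') G' *m Q.
have g1P : g1 *m row_mx (row_mx (X *m G) M) E =
    row_mx (row_mx (X' *m G') M') E' by rewrite -mulmxA P'P mulmx1.
have g2Q : g2 *m row_mx (row_mx (Y *m E) N) G =
    row_mx (row_mx (Y' *m E') N') G' by rewrite -mulmxA Q'Q mulmx1.
move: (g1P) (g2Q); rewrite !mul_mx_row.
move/eq_row_mx=> [/eq_row_mx[g1G g1M] g1E].
move/eq_row_mx=> [/eq_row_mx[g2E g2N] g2G].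
have [XYE YXG] : X *m (Y *m E) = 0 /\ Y *m (X *m G) = 0.
  by rewrite !mulmxA XY YX !mul0mx.
have [XYE' YXG'] : X' *m (Y' *m E') = 0 /\ Y' *m (X' *m G') = 0.
  by case: tX' => -[XY' YX'] _ _ _ _; rewrite !mulmxA XY' YX' !mul0mx.
exists g1, g2; split.
- split; rewrite -row_free_unit; apply/row_freeP.
  + by exists (row_mx (row_mx (X *m G) M) E *m S); rewrite mulmxA g1P.
  + by exists (row_mx (row_mx (Y *m E) N) G *m T); rewrite mulmxA g2Q.
- rewrite -[LHS]mulmx1 -[RHS]mulmx1 -QQ' 2!mulmxA; congr (_ *m _).
  rewrite -2!mulmxA g2Q !mul_mx_row XYE XYE' XN XN' !mulmx0.
  by rewrite g1G.
- rewrite -[LHS]mulmx1 -[RHS]mulmx1 -PP' 2!mulmxA; congr (_ *m _).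
  rewrite -2!mulmxA g1P !mul_mx_row YXG YXG' YM YM' !mulmx0.
  by rewrite g2E.
- rewrite vE wE; case: (j) => [|[|_]]; rewrite !mulmxA.
  + by rewrite -(mulmxA g1) g1G.
  + by rewrite g1M.
  + by rewrite g1E.
Qed.

End NilpotentPairs.

(** * Fibres of the conormal bundles *)

Section Fibre.
Context {F : fieldType}.

(* The conditions on x = block_mx (v *m phi) X Y 0 to be conormal at (W, L); the
   matrix row_mx y1 y2 expresses Im x < W. *)
Definition conormal_fibre p q k (A1 : 'M[F]_(p, k)) (A2 : 'M[F]_(q, k))
    (v : 'cV[F]_p) (phi : 'rV[F]_p) (X : 'M[F]_(p, q)) (Y : 'M[F]_(q, p)) :=
  [/\ v *m phi *m A1 + X *m A2 = 0, Y *m A1 = 0, phi *m v = 0 &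
    exists y1 y2, [/\ v *m phi = A1 *m y1, X = A1 *m y2, Y = A2 *m y1 &
      A2 *m y2 = 0]].

Lemma row_neq0_section n (w : 'rV[F]_n) : w != 0 ->
  exists z : 'cV[F]_n, w *m z = 1%:M.
Proof.
move=> w0; have /row_freeP[z wz] : row_free w by rewrite /row_free rank_rV w0.
by exists z.
Qed.

Lemma mxrank_mul_rV m n (u : 'cV[F]_m) (w : 'rV[F]_n) :
  (\rank (u *m w) <= 1)%N.
Proof. by rewrite (leq_trans (mxrankM_maxr _ _)) // rank_leq_row. Qed.

Lemma col_neq0_retraction n (v : 'cV[F]_n) : v != 0 ->
  exists w : 'rV[F]_n, w *m v = 1%:M.
Proof.
rewrite -trmx_eq0 => /row_neq0_section[z] /(congr1 trmx).
by rewrite trmx_mul trmxK trmx1 => <-; exists z^T.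
Qed.

Section Bounds.
Variables (p q k a b j : nat) (A1 : 'M[F]_(p, k)) (A2 : 'M[F]_(q, k)).
Variables (v : 'cV[F]_p) (phi : 'rV[F]_p).
Variables (X : 'M[F]_(p, q)) (Y : 'M[F]_(q, p)).
Hypothesis tA : pair_type a b j A1 A2 v.
Hypothesis fA : conormal_fibre A1 A2 v phi X Y.

(** If [phi *m A1] is nonzero, the equation [X *m A2 = - (v *m phi *m A1)] puts v in Im X, hence in
    W∩V1, so j = 0. If a + b = k, then W is the sum of W∩V2, where [A1] vanishes, and of W∩V1, where
    [A2] and so [phi *m A1] vanish. *)
Lemma phiA1_eq0 : (j != 0%N) || (a + b == k)%N -> phi *m A1 = 0.
Proof.
case: tA fA => rA1 rA2 rA v0 jv [E1 _ _ [y1 [y2 [_ XE _ Ay2]]]] jab.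
apply/eqP/negP => /negP pA0.
have [z pz] := row_neq0_section pA0.
have vE : v = A1 *m (- (y2 *m A2 *m z)).
  move/eqP: E1; rewrite addr_eq0 => /eqP/(congr1 (mulmx^~ z)).
  by rewrite -!mulmxA (mulmxA phi) pz mulmx1 mulNmx XE mulmxN !mulmxA.
have j0 : j = 0%N.
  case: (j) jv => // -[[_ []]|m []]; last by exists (- (y2 *m A2 *m z)).
  by exists (- (y2 *m A2 *m z)); split=> //; rewrite mulmxN !mulmxA Ay2 !mul0mx oppr0.
move: jab; rewrite j0 /= => /eqP ab.
have [K1 [AK1 rK1 _]] := kernel_basis rA1.
have [K2 [AK2 rK2 _]] := kernel_basis rA2.
have rK : \rank (row_mx K2 K1) = k.
  by rewrite (rank_kernels rA AK2 AK1 rK2 rK1).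
have [L KL _] := full_rank_inverse rK (esym ab).
move/eqP: pA0; apply; rewrite -[LHS]mulmx1 -KL mulmxA.
suff -> : phi *m A1 *m row_mx K2 K1 = 0 by rewrite mul0mx.
rewrite mul_mx_row -[X in row_mx _ X]mulmxA AK1 mulmx0.
suff -> : phi *m A1 *m K2 = 0 by rewrite row_mx0.
have [vi vv] := col_neq0_retraction v0.
rewrite -[LHS]mul1mx -vv -mulmxA.
suff -> : v *m (phi *m A1 *m K2) = 0 by rewrite mulmx0.
move/eqP: E1; rewrite addr_eq0 => /eqP/(congr1 (mulmx^~ K2)).
by rewrite !mulmxA => ->; rewrite mulNmx -mulmxA AK2 mulmx0 oppr0.
Qed.

(** Im X is contained in W∩V1, since [X = A1 *m y2] with [A2 *m y2 = 0]. *)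
Lemma rank_X_le_a : (\rank X <= a)%N.
Proof.
case: tA fA => _ rA2 _ _ _ [_ _ _ [y1 [y2 [_ -> _ /mulmx0_rank_max le]]]].
by apply: leq_trans (mxrankM_maxr _ _) _; lia.
Qed.

(** Sylvester's inequality for [X *m A2], which equals [- (v *m phi *m A1)] and so has rank at most
    one, and rank 0 when [phiA1_eq0] applies. *)
Lemma rank_X_le : (\rank X + k <= q + a + ((j == 0) && (a + b < k)))%N.
Proof.
case: tA fA => _ rA2 rA _ jv [E1 _ _ _].
have := mxrank_mul_min X A2.
have : (\rank (X *m A2) <= ((j == 0) && (a + b < k)))%N; last by lia.
have XA : X *m A2 = - (v *m (phi *m A1)).
  by apply/eqP; rewrite -addr_eq0 addrC mulmxA E1.
case: (boolP (_ && _)) => [_|h].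
  by rewrite XA -mulNmx mxrank_mul_rV.
have abk := pair_type_leq tA.
rewrite XA phiA1_eq0 ?mulmx0 ?oppr0 ?mxrank0 //.
by move: h; rewrite negb_and; case: (j == 0%N) => //=; lia.
Qed.

Lemma rank_Y_le_p : (\rank Y + k <= p + b)%N.
Proof. by case: tA fA => rA1 _ _ _ _ [_ /mulmx0_rank_max le _ _]; lia. Qed.

Lemma phi_eq0 : (1 < j)%N -> phi = 0.
Proof.
case: tA fA => _ _ _ _ jv [_ _ _ [y1 [_ [E _ _ _]]]] j1.
apply/eqP/negP => /negP/row_neq0_section[z pz].
case: (j) j1 jv => // -[//|m] _ []; exists (y1 *m z).
by rewrite mulmxA -E -mulmxA pz mulmx1.
Qed.

(** Both blocks factor through [y1], whose rank is at most b + 1: [A1] has a kernel of dimension b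
    and sends [y1] to a matrix of rank at most one. *)
Lemma rank_vphi_Y : (j <= 1)%N ->
  (\rank (col_mx Y (v *m phi)) <= b + 1)%N.
Proof.
case: tA fA => rA1 _ _ _ _ [_ _ _ [y1 [_ [E _ YE _]]]] _.
have -> : col_mx Y (v *m phi) = col_mx A2 A1 *m y1.
  by rewrite mul_col_mx E YE.
apply: leq_trans (mxrankM_maxr _ _) _.
by have := mxrank_mul_min A1 y1; have := mxrank_mul_rV v phi; rewrite E; lia.
Qed.

(** Outside j = 1 the matrix [y1] can be moved into the kernel of [A1] without changing Y: for j > 1
    because phi = 0, for j = 0 by subtracting [u *m phi], where u is the coordinate vector of v in W
    and [A2 *m u = 0]. *)
Lemma rank_Y_le : (\rank Y <= b + (j == 1))%N.
Proof.
case: tA fA => rA1 rA2 _ _ jv [_ _ _ [y1 [_ [E _ YE _]]]].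
case: (eqVneq j 1%N) => [j1|j1].
  have le : (j <= 1)%N by rewrite j1.
  apply: leq_trans (rank_vphi_Y le).
  by apply: mxrankS; rewrite -addsmxE addsmxSl.
suff [y Ay ->] : exists2 y, A1 *m y = 0 & Y = A2 *m y.
  by apply: leq_trans (mxrankM_maxr _ _) _; have := mulmx0_rank_max Ay; lia.
case: (ltnP 1 j) => [/phi_eq0 p0|j2].
  by exists y1 => //; rewrite -E p0 mulmx0.
have j0 : j = 0%N by case: (j) j1 j2 => // -[].
move: jv; rewrite j0 => -[u [vu Au]]; exists (y1 - u *m phi).
  by rewrite mulmxBr -E mulmxA -vu subrr.
by rewrite mulmxBr mulmxA Au mul0mx subr0.
Qed.

Lemma Yv_eq0 : (j <= 1)%N -> Y *m v = 0.
Proof.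
case: tA fA => _ _ _ _ jv [_ YA _ _] j1.
have [u ->] : exists u, v = A1 *m u.
  by case: (j) j1 jv => [_ [u [vu _]]|[_ []|]]; first by exists u.
by rewrite mulmxA YA mul0mx.
Qed.

(* The second bound comes from row_mx X v *m col_mx A2 (phi *m A1) = 0. *)
Lemma rank_Xv_le : j = 0%N ->
  (\rank (row_mx X v) <= a)%N /\ (\rank (row_mx X v) + k <= q + a + 1)%N.
Proof.
case: tA fA => rA1 rA2 rA _ jv [E1 _ _ [_ [y2 [_ XE _ Ay2]]]] j0.
move: jv; rewrite j0 => -[u [vu Au]]; split.
  rewrite XE vu -mul_mx_row (leq_trans (mxrankM_maxr _ _)) //.
  have : A2 *m row_mx y2 u = 0 by rewrite mul_mx_row Ay2 Au row_mx0.
  by move/mulmx0_rank_max; lia.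
have : row_mx X v *m col_mx A2 (phi *m A1) = 0.
  by rewrite mul_row_col mulmxA addrC E1.
move/mulmx0_rank_max.
have : (\rank A2 <= \rank (col_mx A2 (phi *m A1)))%N.
  by apply: mxrankS; rewrite -addsmxE addsmxSl.
by lia.
Qed.

Lemma notin_im_X : (0 < j)%N -> ~ (exists f, v = X *m f).
Proof.
case: tA fA => _ _ _ _ jv [_ _ _ [_ [y2 [_ XE _ Ay2]]]] j0 [f vf].
have vE : v = A1 *m (y2 *m f) by rewrite mulmxA -XE.
case: (j) j0 jv => // -[|m] _.
  by case=> _; apply; exists (y2 *m f); split=> //; rewrite mulmxA Ay2 mul0mx.
by apply; exists (y2 *m f).
Qed.

(** X Y = X A2 y1 = - v phi A1 y1 = - v (phi v) phi = 0. *)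
Lemma X_Y_square0 : X *m Y = 0 /\ Y *m X = 0.
Proof.
case: fA => E1 YA pv [y1 [y2 [E XE YE Ay2]]]; split; last first.
  by rewrite XE mulmxA YA mul0mx.
move/eqP: E1; rewrite addr_eq0 => /eqP/(congr1 (mulmx^~ y1)).
rewrite -!mulmxA -E (mulmxA phi) pv mul0mx mulmx0 mulNmx => /esym/eqP.
by rewrite oppr_eq0 -mulmxA -YE => /eqP.
Qed.

End Bounds.
End Fibre.

(** The last clause says that the j-th step of the flag 0 ⊂ W∩V1 ⊂ (W+V2)∩V1 ⊂ V1 is strict, so that
    a line L in this position exists. *)
Definition admissible p q k a b j : bool :=
  [&& a + b <= k, k <= p + b, k <= q + a, j < 3 &
    match j with 0 => 0 < a | 1 => a + b < k | _ => k < p + b end]%N.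

(* The ranks of x12 and x21 at the generic point of the bundle of type
   (a, b, j). *)
Definition gen_r q k a b j : nat :=
  if (k <= q)%N then a else (a + q - k + ((j == 0) && (a + b < k)))%N.

Definition gen_s p k b j : nat :=
  if (k < p)%N then (b + (j == 1))%N else (b + p - k)%N.

(** * Explicit generic points of the conormal bundles *)

Section Generic.
Context {F : fieldType}.

(** The first four conditions determine the orbit of (L, x12, x21). The last three concern x1, which
    the projection to the exotic cone forgets; they serve to separate the bundles. *)
Definition generic_fibre p q k a b j (A1 : 'M[F]_(p, k)) (v : 'cV[F]_p)
    (phi : 'rV[F]_p) (X : 'M[F]_(p, q)) (Y : 'M[F]_(q, p)) : Prop :=
  [/\ \rank X = gen_r q k a b j, \rank Y = gen_s p k b j,
      j = 0%N -> (q < k)%N -> (a + b = k)%N -> ~ (exists f, v = X *m f),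
      (1 < j)%N -> (0 < b)%N -> Y *m v != 0 &
    [/\ (j <= 1)%N -> (k < p + b)%N -> phi != 0,
        j = 0%N -> (a + b < k)%N -> phi *m A1 != 0 &
        (j <= 1)%N -> (k < p)%N -> (b < \rank (col_mx Y (v *m phi)))%N]].

Lemma max_rank_avoiding a e : (0 < a)%N ->
  exists (B : 'M[F]_(a, e)) (v : 'cV[F]_a), [/\ \rank B = minn a e, v != 0 &
    (e < a)%N -> ~ (exists u, v = B *m u)].
Proof.
move=> a0; exists (pid_mx (minn a e)).
have rB : \rank (pid_mx (minn a e) : 'M[F]_(a, e)) = minn a e.
  by rewrite rank_pid_mx ?geq_minl ?geq_minr.
case: (boolP (e < a)%N) => ea; last first.
  exists (delta_mx (Ordinal a0) 0); split => //.
  apply/eqP => /matrixP/(_ (Ordinal a0) 0); rewrite !mxE !eqxx /=.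
  by move/eqP; rewrite oner_eq0.
have /row_subPn[i ni] : ~~ (1%:M <= (pid_mx (minn a e) : 'M[F]_(a, e))^T)%MS.
  apply: contraL ea => /mxrankS; rewrite mxrank1 mxrank_tr rB -leqNgt.
  by move/leq_trans; apply; rewrite geq_minr.
have nv : ~ (exists u,
    (row i 1%:M)^T = (pid_mx (minn a e) : 'M[F]_(a, e)) *m u).
  move=> -[u uE]; have := congr1 trmx uE; rewrite trmxK trmx_mul => E.
  by case/negP: ni; rewrite E submxMl.
exists (row i 1%:M)^T; split => //.
by apply/eqP => v0; apply: nv; exists 0; rewrite v0 mulmx0.
Qed.

Lemma max_rank_avoiding_row a e : (0 < a)%N ->
  exists (B : 'M[F]_(e, a)) (v : 'rV[F]_a), [/\ \rank B = minn a e, v != 0 &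
    (e < a)%N -> ~ (exists u, v = u *m B)].
Proof.
case/(max_rank_avoiding e) => B [v [rB v0 nv]]; exists B^T, v^T.
split; rewrite ?mxrank_tr ?trmx_eq0 //.
move=> /nv{}nv [u /(congr1 trmx)]; rewrite trmxK trmx_mul trmxK => E.
by apply: nv; exists u^T.
Qed.

Section Model.
Variables (a b c d e : nat).

(* In bases adapted to W, V1 has blocks of sizes a, c, d and V2 has blocks of
   sizes b, c, e; the two blocks of size c are identified by W. *)
Definition A1m : 'M[F]_(a + (c + d), a + (b + c)) :=
  block_mx 1%:M 0 0 (col_mx (row_mx 0 1%:M) 0).
Definition A2m : 'M[F]_(b + (c + e), a + (b + c)) :=
  row_mx 0 (block_mx 1%:M 0 0 (col_mx 1%:M 0)).

Lemma mul_A1m l (z1 : 'M[F]_(a, l)) (z2 : 'M[F]_(b, l)) (z3 : 'M[F]_(c, l)) :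
  A1m *m col_mx z1 (col_mx z2 z3) = col_mx z1 (col_mx z3 0).
Proof.
by rewrite mul_block_col mul_col_mx mul_row_col !mul0mx !mul1mx addr0 !add0r.
Qed.

Lemma mul_A2m l (z1 : 'M[F]_(a, l)) (z2 : 'M[F]_(b, l)) (z3 : 'M[F]_(c, l)) :
  A2m *m col_mx z1 (col_mx z2 z3) = col_mx z2 (col_mx z3 0).
Proof.
rewrite mul_row_col mul0mx add0r mul_block_col mul_col_mx !mul0mx !mul1mx.
by rewrite addr0 !add0r.
Qed.

Lemma mul_row_A1m l (z1 : 'M[F]_(l, a)) (z2 : 'M[F]_(l, c)) (z3 : 'M[F]_(l, d)) :
  row_mx z1 (row_mx z2 z3) *m A1m = row_mx z1 (row_mx 0 z2).
Proof.
by rewrite mul_row_block mul_row_col mul_mx_row !mulmx0 !mulmx1 !addr0 add0r.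
Qed.

Lemma mul_row_A2m l (z1 : 'M[F]_(l, b)) (z2 : 'M[F]_(l, c)) (z3 : 'M[F]_(l, e)) :
  row_mx z1 (row_mx z2 z3) *m A2m = row_mx 0 (row_mx z1 z2).
Proof.
rewrite mul_mx_row mulmx0 mul_row_block mul_row_col !mulmx0 !mulmx1 !addr0.
by rewrite add0r.
Qed.

Lemma rank_A1m : \rank A1m = (a + c)%N.
Proof. by rewrite rank_diag_block_mx rank_col_mx0 rank_row_0mx !mxrank1. Qed.

Lemma rank_A2m : \rank A2m = (b + c)%N.
Proof. by rewrite rank_row_0mx rank_diag_block_mx rank_col_mx0 !mxrank1. Qed.

Lemma rank_A12m : \rank (col_mx A1m A2m) = (a + (b + c))%N.
Proof.
apply: rank_col_inj => z; rewrite -[z]vsubmxK -[dsubmx z]vsubmxK.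
rewrite mul_col_mx mul_A1m mul_A2m => /eqP; rewrite !col_mx_eq0.
by case/andP=> /and3P[/eqP-> /eqP-> _] /andP[/eqP-> _]; rewrite !col_mx0.
Qed.

Variables (vA : 'cV[F]_a) (vC : 'cV[F]_c) (vP : 'cV[F]_d).
Variables (pC : 'rV[F]_c) (pP : 'rV[F]_d).
Variables (beta : 'M[F]_(a, e)) (gamma : 'M[F]_(b, d)).

Definition vm : 'cV[F]_(a + (c + d)) := col_mx vA (col_mx vC vP).
Definition phim : 'rV[F]_(a + (c + d)) := row_mx 0 (row_mx pC pP).
(** Only [beta] and [gamma] are free. The equation [X *m A2 = - (v *m phi *m A1)] forces the block
    [- (vA *m pC)], and the block of size c of [y1], common to V1 and V2, copies [vC *m phi] from x1
    into Y. *)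
Definition Xm : 'M[F]_(a + (c + d), b + (c + e)) :=
  col_mx (row_mx 0 (row_mx (- (vA *m pC)) beta)) 0.
Definition Ym : 'M[F]_(b + (c + e), a + (c + d)) :=
  col_mx (row_mx 0 (row_mx 0 gamma))
    (col_mx (row_mx 0 (row_mx 0 (vC *m pP))) 0).

Hypotheses (vpC : vC *m pC = 0) (vpPC : vP *m pC = 0) (vpPP : vP *m pP = 0).
Hypothesis pv : pC *m vC + pP *m vP = 0.

Lemma vphim : vm *m phim =
  A1m *m col_mx (vA *m phim) (col_mx (row_mx 0 (row_mx 0 gamma)) (vC *m phim)).
Proof.
rewrite mul_A1m /vm !mul_col_mx; congr (col_mx _ (col_mx _ _)).
by rewrite !mul_mx_row vpPC vpPP mulmx0 !row_mx0.
Qed.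

Lemma conormal_fibre_model : conormal_fibre A1m A2m vm phim Xm Ym.
Proof.
split.
- rewrite -mulmxA mul_row_A1m /vm /Xm !mul_col_mx mul_row_A2m.
  rewrite mul0mx !mul_mx_row !mulmx0 vpC vpPC !row_mx0 !col_mx0.
  by rewrite add_col_mx !add_row_mx !addr0 subrr !row_mx0 col_mx0.
- by rewrite !mul_col_mx !mul_row_A1m !mul0mx !row_mx0 !col_mx0.
- by rewrite mul_row_col mul_row_col mul0mx add0r pv.
- exists (col_mx (vA *m phim)
     (col_mx (row_mx 0 (row_mx 0 gamma)) (vC *m phim))).
  exists (col_mx (row_mx 0 (row_mx (- (vA *m pC)) beta)) 0); split.
  + exact: vphim.
  + by rewrite mul_block_col !mul0mx !mulmx0 !mul1mx !addr0.
  + by rewrite mul_A2m !mul_mx_row vpC mulmx0.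
  + by rewrite mul_row_col mul0mx mulmx0 addr0.
Qed.

Lemma rank_Xm : \rank Xm = \rank (row_mx beta (- (vA *m pC))).
Proof. by rewrite rank_col_mx0 rank_row_0mx rank_row_mxC. Qed.

Lemma rank_Ym : \rank Ym = \rank (col_mx gamma (vC *m pP)).
Proof.
rewrite /Ym col_mxA eqmx_cast rank_col_mx0.
by do 2!rewrite -block_mxEv block_mxEh col_mx0 rank_row_0mx.
Qed.

End Model.

Lemma max_rank_avoiding_row0 a e :
  exists (B : 'M[F]_(e, a)) (v : 'rV[F]_a), [/\ \rank B = minn a e,
    (0 < a)%N -> v != 0 & (e < a)%N -> ~ (exists u, v = u *m B)].
Proof.
case: (posnP a) => [->|/(max_rank_avoiding_row e)[B [v [rB v0 nv]]]].
  by exists 0, 0; split; rewrite // mxrank0 min0n.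
by exists B, v.
Qed.

Lemma const_mx1_neq0 c : (0 < c)%N -> const_mx 1 != 0 :> 'rV[F]_c.
Proof.
move=> c0; apply/eqP => /matrixP/(_ 0 (Ordinal c0)); rewrite !mxE.
by move/eqP; rewrite oner_eq0.
Qed.

Lemma rank_row_mx_avoid m n l (B : 'M[F]_(m, n)) (v : 'cV[F]_m) (w : 'rV[F]_l) :
  w != 0 -> ~ (exists u, v = B *m u) ->
  (\rank B < \rank (row_mx B (v *m w)))%N.
Proof.
move=> /row_neq0_section[z wz] nv; rewrite ltnNge; apply/negP.
case/rank_row_mxP => u uE; apply: nv; exists (u *m z).
by rewrite mulmxA -uE -mulmxA wz mulmx1.
Qed.

Lemma rank_col_mx_avoid m n l (B : 'M[F]_(m, n)) (v : 'cV[F]_l) (w : 'rV[F]_n) :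
  v != 0 -> ~ (exists u, w = u *m B) ->
  (\rank B < \rank (col_mx B (v *m w)))%N.
Proof.
move=> v0 nw; rewrite -(mxrank_tr B) -(mxrank_tr (col_mx _ _)) tr_col_mx trmx_mul.
apply: rank_row_mx_avoid; first by rewrite trmx_eq0.
move=> [u /(congr1 trmx)]; rewrite trmx_mul !trmxK => wE.
by apply: nw; exists u^T.
Qed.

Lemma leq_rank_row_mx m n1 n2 (A : 'M[F]_(m, n1)) (B : 'M[F]_(m, n2)) :
  (\rank A <= \rank (row_mx A B))%N.
Proof.
by rewrite -mxrank_tr -(mxrank_tr (row_mx A B)) tr_row_mx mxrankS // -addsmxE addsmxSl.
Qed.

Lemma leq_rank_col_mx m1 m2 n (A : 'M[F]_(m1, n)) (B : 'M[F]_(m2, n)) :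
  (\rank A <= \rank (col_mx A B))%N.
Proof. by rewrite mxrankS // -addsmxE addsmxSl. Qed.

Lemma exists_mulmx_neq0 m n (A : 'M[F]_(m, n)) : A != 0 ->
  exists v : 'cV[F]_n, A *m v != 0.
Proof.
case/matrix0Pn => i [l Ail]; exists (delta_mx l 0).
by apply/eqP => /matrixP/(_ i 0); rewrite -colE !mxE => /eqP; rewrite (negPf Ail).
Qed.

Lemma generic_exists p q k a b j : admissible p q k a b j ->
  exists (A1 : 'M[F]_(p, k)) (A2 : 'M[F]_(q, k)) (v : 'cV[F]_p)
    (phi : 'rV[F]_p) (X : 'M[F]_(p, q)) (Y : 'M[F]_(q, p)),
  [/\ pair_type a b j A1 A2 v, conormal_fibre A1 A2 v phi X Y &
      generic_fibre a b j A1 v phi X Y].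
Proof.
case/and5P => abk kp kq j3 jv.
have kE : k = (a + (b + (k - a - b)))%N by lia.
have pE : p = (a + (k - a - b + (p + b - k)))%N by lia.
have qE : q = (b + (k - a - b + (q + a - k)))%N by lia.
move: (k - a - b)%N (p + b - k)%N (q + a - k)%N kE pE qE => c d e kE pE qE.
subst k p q => {kp kq abk}.
have [gamma [pP [rg p0 np]]] := max_rank_avoiding_row0 d b.
have rA1 : (\rank (A1m a b c d) + b = a + (b + c))%N.
  by rewrite rank_A1m; lia.
have rA2 : (\rank (A2m a b c e) + a = a + (b + c))%N.
  by rewrite rank_A2m; lia.
have rA12 := rank_A12m a b c d e.
case: j jv j3 => [|[|[|//]]] /= jv _.
(* j = 0: v lies in the block of size a and phi is nonzero on that of size c, so X contains
   [- (vA *m pC)]; this raises its rank because vA avoids the image of [beta]. *)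
- have [beta [vA [rb v0 nv]]] := max_rank_avoiding e jv.
  pose v := vm vA (0 : 'cV_c) (0 : 'cV_d).
  pose phi := phim a (const_mx 1 : 'rV_c) pP.
  pose X := Xm b d vA (const_mx 1 : 'rV_c) beta.
  pose Y := Ym a e (0 : 'cV_c) pP gamma.
  have v0' : v != 0 by rewrite /v /vm !col_mx_eq0 negb_and v0.
  have tA : pair_type a b 0 (A1m a b c d) (A2m a b c e) v.
    split=> //; exists (col_mx vA 0).
    by rewrite -[0 : 'cV_(b + c)]col_mx0 mul_A1m mul_A2m /v /vm !col_mx0.
  have fA : conormal_fibre (A1m a b c d) (A2m a b c e) v phi X Y.
    by apply: conormal_fibre_model; rewrite ?mul0mx ?mulmx0 ?addr0.
  have rY : \rank Y = minn d b.
    by rewrite rank_Ym mul0mx rank_col_mx0.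
  exists (A1m a b c d), (A2m a b c e), v, phi, X, Y; split => //; split => //.
  + have := rank_X_le_a tA fA; have := rank_X_le tA fA; rewrite /gen_r.
    have : (\rank beta <= \rank X)%N by rewrite rank_Xm leq_rank_row_mx.
    have : (0 < c)%N -> (e < a)%N -> (e < \rank X)%N.
      move=> c0 ea; have nv' : ~ exists u, - vA = beta *m u.
        move=> [u uE]; apply: (nv ea).
        by exists (- u); rewrite mulmxN -uE opprK.
      rewrite rank_Xm -mulNmx.
      apply: leq_ltn_trans (rank_row_mx_avoid (const_mx1_neq0 c0) nv').
      by rewrite rb; lia.
    by rewrite rb; case: ifP; lia.
  + by rewrite rY /gen_s; case: ifP; lia.
  (* With c = 0 the block [- (vA *m pC)] is empty, so v in Im X would put vA in the image of
     [beta]. *)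
  + move=> _ ea abc [f fE]; have c0 : c = 0%N by lia.
    apply: nv; first by lia.
    have fD : f = col_mx (usubmx f)
      (col_mx (usubmx (dsubmx f)) (dsubmx (dsubmx f))) by rewrite !vsubmxK.
    exists (dsubmx (dsubmx f)); move: fE; rewrite [in X in _ = X -> _]fD.
    rewrite /X /Xm mul_col_mx !mul_row_col => /eq_col_mx[-> _].
    have -> : const_mx 1 = 0 :> 'rV[F]_c.
      by apply/matrixP => x [y ylt]; move: ylt; rewrite c0.
    by rewrite mulmx0 oppr0 !mul0mx !add0r.
  split.
  + by move=> _ dP; rewrite !row_mx_eq0 !negb_and p0 ?orbT //; lia.
  + move=> _ cP; rewrite mul_row_A1m !row_mx_eq0 !negb_and const_mx1_neq0 ?orbT //.
    by lia.
  + move=> _ bd; have {}bd : (b < d)%N by lia.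
    apply: leq_trans (rank_col_mx_avoid v0' _); first by rewrite rY ltnS; lia.
    move=> [u]; rewrite -[u]hsubmxK -[rsubmx u]hsubmxK !mul_row_col.
    rewrite mulmx0 addr0 !mul_mx_row mul0mx !mulmx0 add_row_mx => /eq_row_mx[_].
    by rewrite row_mx0 addr0 => /eq_row_mx[_ pE]; apply: (np bd); exists (lsubmx u).
(* j = 1: v lies in the block of size c and [pC] is 0; the row [pP], outside the row space of
   [gamma] when b < d, adds one to the rank of Y through [vC *m pP]. *)
- have rb : \rank (pid_mx (minn a e) : 'M[F]_(a, e)) = minn a e.
    by rewrite rank_pid_mx ?geq_minl ?geq_minr.
  move: (pid_mx _) rb => beta rb.
  have c0 : (0 < c)%N by lia.
  have [vC vC0] : exists vC : 'cV[F]_c, vC != 0.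
    by exists (const_mx 1)^T; rewrite trmx_eq0 const_mx1_neq0.
  pose v := vm (0 : 'cV_a) vC (0 : 'cV_d).
  pose phi := phim a (0 : 'rV_c) pP.
  pose X := Xm b d (0 : 'cV_a) (0 : 'rV_c) beta.
  pose Y := Ym a e vC pP gamma.
  have v0' : v != 0 by rewrite /v /vm !col_mx_eq0 !negb_and vC0 orbT.
  have tA : pair_type a b 1 (A1m a b c d) (A2m a b c e) v.
    split=> //; split.
      by exists (col_mx 0 (col_mx 0 vC)); rewrite mul_A1m.
    move=> [u]; rewrite -[u]vsubmxK -[dsubmx u]vsubmxK mul_A1m mul_A2m.
    case=> /eq_col_mx[_ /eq_col_mx[vE _]] /eqP; rewrite !col_mx_eq0.
    by case/and3P => _ /eqP uE _; case/eqP: vC0; rewrite vE.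
  have fA : conormal_fibre (A1m a b c d) (A2m a b c e) v phi X Y.
    by apply: conormal_fibre_model; rewrite ?mul0mx ?mulmx0 ?addr0.
  have rY : (minn d b <= \rank Y)%N by rewrite rank_Ym -rg leq_rank_col_mx.
  have rY' : (b < d)%N -> (b < \rank Y)%N.
    move=> bd; rewrite rank_Ym.
    by apply: leq_trans (rank_col_mx_avoid vC0 (np bd)); rewrite rg ltnS; lia.
  exists (A1m a b c d), (A2m a b c e), v, phi, X, Y; split => //; split => //.
  + have := rank_X_le_a tA fA; have := rank_X_le tA fA; rewrite /gen_r.
    have : (\rank beta <= \rank X)%N by rewrite rank_Xm leq_rank_row_mx.
    by rewrite rb; case: ifP; lia.
  + have := rank_Y_le tA fA; have := rank_Y_le_p tA fA; rewrite /gen_s.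
    by case: ifP; lia.
  split=> //.
  + by move=> _ dP; rewrite !row_mx_eq0 !negb_and p0 ?orbT //; lia.
  + by move=> _ bd; apply: leq_trans (leq_rank_col_mx _ _); lia.
(* j = 2: v lies in the block of size d, so phi = 0; it is chosen outside Ker [gamma] as soon as b >
   0. *)
- have rb : \rank (pid_mx (minn a e) : 'M[F]_(a, e)) = minn a e.
    by rewrite rank_pid_mx ?geq_minl ?geq_minr.
  move: (pid_mx _) rb => beta rb.
  have d0 : (0 < d)%N by lia.
  have [vP [vP0 gv]] : exists vP : 'cV[F]_d, vP != 0 /\
      ((0 < b)%N -> gamma *m vP != 0).
    case: (posnP b) => [b0|b0].
      by exists (const_mx 1)^T; rewrite trmx_eq0 const_mx1_neq0.
    have /exists_mulmx_neq0[w gw] : gamma != 0.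
      by rewrite -mxrank_eq0 rg; lia.
    by exists w; split => //; apply: contra gw => /eqP ->; rewrite mulmx0.
  pose v := vm (0 : 'cV_a) (0 : 'cV_c) vP.
  pose phi := phim a (0 : 'rV_c) (0 : 'rV_d).
  pose X := Xm b d (0 : 'cV_a) (0 : 'rV_c) beta.
  pose Y := Ym a e (0 : 'cV_c) (0 : 'rV_d) gamma.
  have v0' : v != 0 by rewrite /v /vm !col_mx_eq0 !negb_and vP0 !orbT.
  have tA : pair_type a b 2 (A1m a b c d) (A2m a b c e) v.
    split=> //; move=> [u]; rewrite -[u]vsubmxK -[dsubmx u]vsubmxK mul_A1m.
    by case/eq_col_mx => _ /eq_col_mx[_ vE]; case/eqP: vP0.
  have fA : conormal_fibre (A1m a b c d) (A2m a b c e) v phi X Y.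
    by apply: conormal_fibre_model; rewrite ?mul0mx ?mulmx0 ?addr0.
  exists (A1m a b c d), (A2m a b c e), v, phi, X, Y; split => //; split => //.
  + have := rank_X_le_a tA fA; have := rank_X_le tA fA; rewrite /gen_r.
    have : (\rank beta <= \rank X)%N by rewrite rank_Xm leq_rank_row_mx.
    by rewrite rb; case: ifP; lia.
  + have := rank_Y_le tA fA; have := rank_Y_le_p tA fA; rewrite /gen_s.
    have : (\rank gamma <= \rank Y)%N by rewrite rank_Ym leq_rank_col_mx.
    by rewrite rg; case: ifP; lia.
  + move=> _ b0; rewrite mul_col_mx col_mx_eq0 negb_and.
    by rewrite !mul_row_col !mul0mx !add0r gv.
Qed.

End Generic.

(** * Action of K on pairs and on fibres, and linearity of the fibres *)

Section Equivariance.
Context {F : fieldType}.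

Lemma mxrank_unitl m n (g : 'M[F]_m) (A : 'M[F]_(m, n)) :
  g \in unitmx -> \rank (g *m A) = \rank A.
Proof. by move=> ug; rewrite eqmxMfull // row_full_unit. Qed.

Lemma mxrank_unitr m n (A : 'M[F]_(m, n)) (h : 'M[F]_n) :
  h \in unitmx -> \rank (A *m h) = \rank A.
Proof. by move=> uh; rewrite mxrankMfree // row_free_unit. Qed.

Lemma mul_diag_block p q (g1 h1 : 'M[F]_p) (g2 h2 : 'M[F]_q) a X Y d :
  block_mx g1 0 0 g2 *m block_mx a X Y d *m block_mx h1 0 0 h2 =
  block_mx (g1 *m a *m h1) (g1 *m X *m h2) (g2 *m Y *m h1) (g2 *m d *m h2).
Proof. by rewrite !mulmx_block !(mul0mx, mulmx0, addr0, add0r). Qed.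

Lemma mul_diag_col p q n (g1 : 'M[F]_p) (g2 : 'M[F]_q) (A1 : 'M[F]_(p, n)) A2 :
  block_mx g1 0 0 g2 *m col_mx A1 A2 = col_mx (g1 *m A1) (g2 *m A2).
Proof. by rewrite mul_block_col !mul0mx addr0 add0r. Qed.

Lemma pair_type_act p q k a b j (A1 : 'M[F]_(p, k)) (A2 : 'M[F]_(q, k))
    (v : 'cV[F]_p) g1 g2 : g1 \in unitmx -> g2 \in unitmx ->
  pair_type a b j A1 A2 v -> pair_type a b j (g1 *m A1) (g2 *m A2) (g1 *m v).
Proof.
move=> u1 u2 [r1 r2 r12 v0 jv]; split; rewrite ?mxrank_unitl //.
- by rewrite -mul_diag_col mxrank_unitl // block_diag_mx_unit u1.
- by apply: contra v0 => /eqP gv; rewrite -(mulKmx u1 v) gv mulmx0.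
have e1 u : g1 *m v = g1 *m A1 *m u <-> v = A1 *m u.
  rewrite -mulmxA; split=> [/(can_inj (mulKmx u1))//|->//].
have e2 (u : 'cV_k) : g2 *m A2 *m u = 0 <-> A2 *m u = 0.
  rewrite -mulmxA; split=> [gA|->]; last by rewrite mulmx0.
  by rewrite -(mulKmx u2 (A2 *m u)) gA mulmx0.
case: j jv => [[u [vu Au]]|[[[u vu] nv]|j nv]] /=.
- by exists u; split; [apply/e1|apply/e2].
- split; first by exists u; apply/e1.
  by move=> [u' [/e1 vu' /e2 Au']]; apply: nv; exists u'.
- by move=> [u' /e1 vu']; apply: nv; exists u'.
Qed.

Lemma pair_type_admissible p q k a b j (A1 : 'M[F]_(p, k)) (A2 : 'M[F]_(q, k))
    (v : 'cV[F]_p) :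
  pair_type a b j A1 A2 v -> (j < 3)%N -> admissible p q k a b j.
Proof.
move=> tA j3; have abk := pair_type_leq tA; case: tA => r1 r2 r12 v0 jv.
have le1 := rank_leq_row A1; have le2 := rank_leq_row A2.
apply/and5P; split=> //; try lia.
case: j jv j3 => [[u [vu Au]]|[[[u vu] nv]|[nv|//]]] _.
- rewrite lt0n; apply/eqP => a0.
  have rA : \rank A2 = k by lia.
  by case/eqP: v0; rewrite vu (mulmx_free0 rA Au) mulmx0.
- rewrite ltn_neqAle abk andbT; apply/eqP => abE.
  have [K1 [AK1 rK1 _]] := kernel_basis r2.
  have [K2 [AK2 rK2 _]] := kernel_basis r1.
  have rK : \rank (row_mx K1 K2) = k by rewrite (rank_kernels r12 AK1 AK2 rK1 rK2).
  have [L KL _] := full_rank_inverse rK (esym abE).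
  apply: nv; exists (K1 *m usubmx (L *m u)); split; last first.
    by rewrite mulmxA AK1 mul0mx.
  rewrite vu -[u in LHS]mul1mx -KL -mulmxA -[L *m u in LHS]vsubmxK mul_row_col.
  by rewrite mulmxDr [A1 *m (K2 *m _)]mulmxA AK2 mul0mx addr0.
- rewrite ltn_neqAle; apply/andP; split; last by lia.
  apply/eqP => kE; have : row_full A1^T by rewrite /row_full mxrank_tr; lia.
  case/row_fullP => B BA; apply: nv; exists (B^T *m v).
  by rewrite mulmxA -[A1]trmxK -trmx_mul BA trmx1 mul1mx.
Qed.

Lemma pair_type_exists p q k (A1 : 'M[F]_(p, k)) (A2 : 'M[F]_(q, k))
    (v : 'cV[F]_p) : \rank (col_mx A1 A2) = k -> v != 0 ->
  exists a b j, pair_type a b j A1 A2 v /\ admissible p q k a b j.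
Proof.
move=> rA v0; have le1 := rank_leq_col A1; have le2 := rank_leq_col A2.
pose a := (k - \rank A2)%N; pose b := (k - \rank A1)%N.
suff [j [jv j3]] : exists j, line_pos j A1 A2 v /\ (j < 3)%N.
  have tA : pair_type a b j A1 A2 v by split=> //; rewrite /a /b; lia.
  by exists a, b, j; split=> //; exact: pair_type_admissible tA j3.
case: (pselect (exists u, v = A1 *m u)) => [h|h]; last by exists 2%N.
case: (pselect (exists u, v = A1 *m u /\ A2 *m u = 0)) => h'; first by exists 0%N.
by exists 1%N.
Qed.

Definition in_fibre p q k (A1 : 'M[F]_(p, k)) (A2 : 'M[F]_(q, k))
    (v : 'cV[F]_p) (x : 'M[F]_(p + q)) : Prop :=
  exists phi X Y, x = block_mx (v *m phi) X Y 0 /\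
    conormal_fibre A1 A2 v phi X Y.

Lemma in_fibreD p q k (A1 : 'M[F]_(p, k)) (A2 : 'M[F]_(q, k)) (v : 'cV[F]_p)
    x y : in_fibre A1 A2 v x -> in_fibre A1 A2 v y -> in_fibre A1 A2 v (x + y).
Proof.
move=> [phi [X [Y [-> [E1 E2 E3 [y1 [y2 [F1 F2 F3 F4]]]]]]]].
move=> [phi' [X' [Y' [-> [E1' E2' E3' [y1' [y2' [F1' F2' F3' F4']]]]]]]].
exists (phi + phi'), (X + X'), (Y + Y'); split.
  by rewrite add_block_mx mulmxDr addr0.
split.
- by rewrite mulmxDr !mulmxDl addrACA E1 E1' addr0.
- by rewrite mulmxDl E2 E2' addr0.
- by rewrite mulmxDl E3 E3' addr0.
- exists (y1 + y1'), (y2 + y2'); rewrite !mulmxDr F1 F1' -F2 -F2' -F3 -F3' F4 F4'.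
  by rewrite addr0.
Qed.

Lemma in_fibreZ p q k (A1 : 'M[F]_(p, k)) (A2 : 'M[F]_(q, k)) (v : 'cV[F]_p)
    c x : in_fibre A1 A2 v x -> in_fibre A1 A2 v (c *: x).
Proof.
move=> [phi [X [Y [-> [E1 E2 E3 [y1 [y2 [F1 F2 F3 F4]]]]]]]].
exists (c *: phi), (c *: X), (c *: Y); split.
  by rewrite scale_block_mx scalemxAr scaler0.
split.
- by rewrite -scalemxAr -!scalemxAl -scalerDr E1 scaler0.
- by rewrite -scalemxAl E2 scaler0.
- by rewrite -scalemxAl E3 scaler0.
- exists (c *: y1), (c *: y2); rewrite -!scalemxAr F1 -F2 -F3 F4.
  by rewrite scaler0.
Qed.

Lemma in_fibre_act p q k (A1 : 'M[F]_(p, k)) (A2 : 'M[F]_(q, k)) (v : 'cV[F]_p)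
    x g1 g2 : g1 \in unitmx -> g2 \in unitmx -> in_fibre A1 A2 v x ->
  in_fibre (g1 *m A1) (g2 *m A2) (g1 *m v)
    (block_mx g1 0 0 g2 *m x *m invmx (block_mx g1 0 0 g2)).
Proof.
move=> u1 u2 [phi [X [Y [-> [E1 E2 E3 [y1 [y2 [F1 F2 F3 F4]]]]]]]].
rewrite invmx_block_diag ?block_diag_mx_unit ?u1 // mul_diag_block.
exists (phi *m invmx g1), (g1 *m X *m invmx g2), (g2 *m Y *m invmx g1); split.
  by rewrite mulmx0 mul0mx !mulmxA.
split.
- rewrite -!mulmxA (mulKmx u1) (mulKmx u2) -mulmxDr.
  by rewrite (mulmxA v) E1 mulmx0.
- by rewrite -!mulmxA (mulKmx u1) E2 mulmx0.
- by rewrite -mulmxA (mulKmx u1) E3.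
- exists (y1 *m invmx g1), (y2 *m invmx g2); split.
  + by rewrite !mulmxA -(mulmxA g1) F1 !mulmxA.
  + by rewrite F2 !mulmxA.
  + by rewrite F3 !mulmxA.
  + by rewrite -mulmxA (mulmxA A2) F4 mul0mx mulmx0.
Qed.

End Equivariance.

(** * Components of a stratified space *)

Section Components.
Context {T : topologicalType}.
Implicit Types (A D F : set T).

Lemma closure_sub_closed A F : closed F -> A `<=` F -> closure A `<=` F.
Proof. by move=> cF AF; rewrite [F](closure_id _).1 //; exact: closure_subset. Qed.

Lemma irreducible_bigcup (I : choiceType) (l : seq I) (F : I -> set T) A :
  irreducible A -> (forall i, closed (F i)) ->
  (forall t, A t -> exists2 i, i \in l & F i t) ->
  exists2 i, i \in l & A `<=` F i.
Proof.
move=> [[t0 At0] irrA] cF; elim: l => [|i l IH] Al.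
  by have [] := Al _ At0.
have cl : closed (\bigcup_(j in [set` l]) F j).
  by rewrite bigcup_seq; apply: closed_bigsetU => j _; exact: cF.
have [t At| |] := irrA _ _ (cF i) cl.
- have [j jl Fj] := Al t At; move: jl; rewrite in_cons => /orP[/eqP ji|jl].
    by left; rewrite -ji.
  by right; exists j.
- by move=> AF; exists i => //; exact: mem_head.
- move=> AF; have [t /AF[j jl Fj]|j jl Aj] := IH; first by exists j.
  by exists j => //; rewrite in_cons jl orbT.
Qed.

Lemma irreducible_between A D : irreducible A -> A `<=` D -> D `<=` closure A ->
  irreducible D.
Proof.
move=> [[t At] irrA] AD DA; split; first by exists t; exact: AD.
move=> F G cF cG DFG.
have [|AF|AG] := irrA F G cF cG; first exact: subset_trans AD DFG.
- by left; apply: subset_trans DA _; exact: closure_sub_closed.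
- by right; apply: subset_trans DA _; exact: closure_sub_closed.
Qed.

Section Stratification.
Context {I : choiceType} {E : Type}.
Variables (l : seq I) (S : I -> set T) (Y : set T).
Hypothesis YE : forall t, Y t <-> exists2 i, i \in l & S i t.
Hypothesis S_irr : forall i, i \in l -> irreducible (S i).
Hypothesis S_incl : forall i j, i \in l -> j \in l ->
  S i `<=` closure (S j) -> i = j.

(** The closure is taken in the ambient space, whereas the members of [Irr Y] are subsets of Y. *)
Definition component i : set T := Y `&` closure (S i).

Lemma sub_component i : i \in l -> S i `<=` component i.
Proof.
move=> il t St; split; last exact: subset_closure.
by apply/YE; exists i.
Qed.

Lemma component_irreducible i : i \in l -> irreducible (component i).
Proof.
move=> il; apply: irreducible_between (S_irr il) (sub_component il) _.
by move=> t [].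
Qed.

Lemma irreducible_sub_component D : D `<=` Y -> irreducible D ->
  exists2 i, i \in l & D `<=` component i.
Proof.
move=> DY irrD.
have [i|t /DY /YE[i il St]|i il DS] :=
    @irreducible_bigcup _ l (fun i => closure (S i)) D irrD.
- exact: closed_closure.
- by exists i => //; exact: subset_closure.
- by exists i => // t Dt; split; [exact: DY | exact: DS].
Qed.

Lemma component_sub i j : i \in l -> j \in l ->
  component i `<=` component j -> i = j.
Proof.
move=> il jl ij; apply: S_incl => // t /(sub_component il)/ij[].
by [].
Qed.

Lemma Irr_component D : Irr Y D <-> exists2 i, i \in l & D = component i.
Proof.
split=> [[DY irrD maxD]|[i il ->]].
  have [i il Di] := irreducible_sub_component DY irrD.
  exists i => //; apply/esym/maxD => //; last exact: component_irreducible.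
  by move=> t [].
split; [by move=> t [] | exact: component_irreducible | move=> D' DY irrD iD].
have [j jl Dj] := irreducible_sub_component DY irrD.
have ij : i = j by apply: component_sub => //; exact: subset_trans iD Dj.
by rewrite eqEsubset; split => //; rewrite ij.
Qed.

Variables (f : T -> E) (O : I -> set E) (Orb : set (set E)).
Hypothesis Orb_disjoint : forall X X' e, Orb X -> Orb X' -> X e -> X' e -> X = X'.
Hypothesis O_Orb : forall i, i \in l -> Orb (O i).
Hypothesis O_generic : forall i, i \in l -> exists U, [/\ open U,
  (exists t, U t /\ S i t) & forall t, U t -> S i t -> O i (f t)].

Lemma component_sub_closure i : i \in l ->
  component i `<=` Y `&` closure (Y `&` f @^-1` (O i)).
Proof.
move=> il t [Yt clS]; split=> //; move: t clS {Yt}.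
apply: closure_sub_closed; first exact: closed_closure.
have [U [oU [t0 [Ut0 St0]] UO]] := O_generic il.
have [_ irrS] := S_irr il.
have [|||SU //|SV] := irrS (closure (Y `&` f @^-1` (O i))) (~` U).
- exact: closed_closure.
- exact: open_closedC.
- move=> t St; case: (pselect (U t)) => [Ut|]; last by right.
  left; apply: subset_closure; split; last exact: UO.
  by apply/YE; exists i.
- by case: (SV _ St0).
Qed.

(** There are finitely many strata, so the closure of the preimage of X is the union of the closures
    of its traces on them, and one of these contains [S i]. By [S_incl] it is the trace on [S i]
    itself, which therefore meets U: X and [O i] share a point. *)
Lemma component_orbit_unique i X : i \in l -> Orb X ->
  component i `<=` Y `&` closure (Y `&` f @^-1` X) -> X = O i.
Proof.
move=> il OX iX.
have [|t St|j jl Sj] := @irreducible_bigcup _ l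
    (fun j => closure (S j `&` f @^-1` X)) (S i) (S_irr il).
- by move=> j; exact: closed_closure.
- have [_] := iX _ (sub_component il St).
  suff : closure (Y `&` f @^-1` X) `<=`
      \bigcup_(j in [set` l]) closure (S j `&` f @^-1` X).
    by move=> h /h [j jl Xj]; exists j.
  apply: closure_sub_closed.
    by rewrite bigcup_seq; apply: closed_bigsetU => j _; exact: closed_closure.
  move=> u [/YE[j jl Sj] Xu]; exists j => //; exact: subset_closure.
have ij : i = j.
  by apply: S_incl => // t /Sj; apply: closure_subset => u [].
have [U [oU [t0 [Ut0 St0]] UO]] := O_generic il.
have /(_ U) := Sj _ St0; rewrite -ij.
case=> [|u [[Su Xu] Uu]]; first exact: open_nbhs_nbhs.
exact: Orb_disjoint OX (O_Orb il) Xu (UO u Uu Su).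
Qed.

End Stratification.
End Components.

(** * Frames and the Zariski topology *)

Section Images.
Context {R : realType}.
Local Notation C := (R[i]).

Lemma mxlfunE m n (A : 'M[C]_(m, n)) u : mxlfun A u = A *m u.
Proof. by rewrite lfunE. Qed.

Lemma memv_imxP m n (A : 'M[C]_(m, n)) w :
  reflect (exists u, w = A *m u) (w \in imx A).
Proof.
apply: (iffP memv_imgP) => [[u _ ->]|[u ->]]; exists u; rewrite ?memvf //;
  by rewrite mxlfunE.
Qed.

Lemma imx_subP m n1 n2 (A : 'M[C]_(m, n1)) (B : 'M[C]_(m, n2)) :
  reflect (exists Z, A = B *m Z) (imx A <= imx B)%VS.
Proof.
apply: (iffP subvP) => [AB|[Z ->] w /memv_imxP[u ->]]; last first.
  by apply/memv_imxP; exists (Z *m u); rewrite mulmxA.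
have /all_sig[z zE] j : {u | col j A = B *m u}.
  apply/cid/memv_imxP/AB/memv_imxP.
  by exists (delta_mx j 0); rewrite colE.
exists (\matrix_(i, j) z j i 0); apply/matrixP => i j.
have /matrixP/(_ i 0) := zE j; rewrite !mxE => ->.
by apply: eq_bigr => l _; rewrite !mxE.
Qed.

Lemma imx_sub_kerxP m n l (A : 'M[C]_(n, l)) (x : 'M[C]_(m, n)) :
  reflect (x *m A = 0) (imx A <= kerx x)%VS.
Proof.
apply: (iffP subvP) => [Ax|xA w /memv_imxP[u ->]]; last first.
  by rewrite memv_ker mxlfunE mulmxA xA mul0mx.
apply/matrixP => i j.
have : col j A \in kerx x.
  by apply/Ax/memv_imxP; exists (delta_mx j 0); rewrite colE.
rewrite memv_ker mxlfunE colE mulmxA -colE => /eqP/matrixP/(_ i 0).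
by rewrite mxE => ->; rewrite !mxE.
Qed.

Lemma dim_imx_free m n (A : 'M[C]_(m, n)) : \rank A = n -> \dim (imx A) = n.
Proof.
move=> rA; rewrite /imx limg_dim_eq ?dimvf /dim /= ?muln1 //.
apply/eqP; rewrite -subv0; apply/subvP => w; rewrite memv_cap memv_ker mxlfunE.
by case/andP => _ /eqP /(mulmx_free0 rA) ->; rewrite mem0v.
Qed.

Lemma imx_eqP m n1 n2 (A : 'M[C]_(m, n1)) (B : 'M[C]_(m, n2)) :
  (imx A <= imx B)%VS -> (imx B <= imx A)%VS -> imx A = imx B.
Proof. by move=> AB BA; apply/eqP; rewrite eqEsubv AB. Qed.

Lemma dim_imx m n (A : 'M[C]_(m, n)) : \dim (imx A) = \rank A.
Proof.
have <- : imx (col_base A) = imx A.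
  apply: imx_eqP; apply/imx_subP.
    have /row_freeP[B rB] := row_base_free A.
    by exists B; rewrite -[LHS]mulmx1 -rB mulmxA mulmx_base.
  by exists (row_base A); rewrite mulmx_base.
apply: dim_imx_free.
by have := col_base_full A; rewrite /row_full => /eqP.
Qed.

Lemma vline_imx m (v : 'cV[C]_m) : <[v]>%VS = imx v.
Proof.
apply/vspaceP => w; apply/vlineP/memv_imxP => [[a ->]|[u ->]].
  by exists a%:M; rewrite mul_mx_scalar.
by exists (u 0 0); rewrite [u in LHS]mx11_scalar mul_mx_scalar.
Qed.

Lemma img_imx m n l (g : 'M[C]_(m, n)) (A : 'M[C]_(n, l)) :
  (mxlfun g @: imx A)%VS = imx (g *m A).
Proof.
rewrite /imx -limg_comp.
suff -> : mxlfun (g *m A) = (mxlfun g \o mxlfun A)%VF by [].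
by apply/lfunP => u; rewrite comp_lfunE !mxlfunE mulmxA.
Qed.

Lemma vspace_frame m k (W : {vspace 'cV[C]_m}) : \dim W = k ->
  exists A : 'M[C]_(m, k), imx A = W /\ \rank A = k.
Proof.
move=> dW; pose A : 'M[C]_(m, \dim W) := \matrix_(i, j) (vbasis W)`_j i 0.
have colA j : col j A = (vbasis W)`_j by apply/matrixP => i l; rewrite !mxE ord1.
have mulA u : A *m u = \sum_j u j 0 *: (vbasis W)`_j.
  apply/matrixP => i l; rewrite !mxE ord1 summxE; apply: eq_bigr => j _.
  by rewrite !mxE mulrC.
have AW : imx A = W.
  apply/vspaceP => w; apply/memv_imxP/idP => [[u ->]|wW].
    rewrite mulA memv_suml // => j _; rewrite memvZ //.
    by apply: vbasis_mem; rewrite mem_nth // size_tuple.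
  exists (\col_j coord (vbasis W) j w).
  by rewrite mulA {1}(coord_vbasis wW); apply: eq_bigr => j _; rewrite mxE.
have rA : \rank A = \dim W by rewrite -dim_imx AW.
by case: _ / dW A AW rA {colA mulA} => A AW rA; exists A.
Qed.

End Images.

(** Compressions [L *m M *m D] replace minors, with no choice of rows and columns. If the rank
    exceeds r, one-sided inverses of the two factors of a rank factorization give a compression
    equal to the identity. *)
Lemma rank_minorsP (F : fieldType) m n (M : 'M[F]_(m, n)) r :
  (\rank M <= r)%N <->
  forall (L : 'M[F]_(r.+1, m)) (D : 'M[F]_(n, r.+1)), \det (L *m M *m D) = 0.
Proof.
split=> [rM L D|h].
  apply/eqP; apply: contraT; rewrite -unitfE -[_ \is a _]unitmxE.
  rewrite -row_free_unit /row_free => /eqP.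
  have := mxrankM_maxl (L *m M) D; have := mxrankM_maxr L M; lia.
rewrite leqNgt; apply/negP => rM.
have [s [rs [B [E [L [D [ME LB ED]]]]]]] : exists s, (r < s)%N /\
    exists (B : 'M[F]_(m, s)) (E : 'M[F]_(s, n)) (L : 'M[F]_(s, m))
      (D : 'M[F]_(n, s)), [/\ M = B *m E, L *m B = 1%:M & E *m D = 1%:M].
  exists (\rank M); split=> //.
  have /row_fullP[L LB] := col_base_full M.
  have /row_freeP[D ED] := row_base_free M.
  by exists (col_base M), (row_base M), L, D; rewrite mulmx_base.
have := h (pid_mx r.+1 *m L) (D *m pid_mx r.+1).
have -> : pid_mx r.+1 *m L *m M *m (D *m pid_mx r.+1) =
    pid_mx r.+1 *m (L *m B) *m (E *m D *m pid_mx r.+1) :> 'M_r.+1.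
  by rewrite ME !mulmxA.
rewrite LB ED mulmx1 mul1mx pid_mx_id // pid_mx_1 det1 => /eqP.
by rewrite oner_eq0.
Qed.

Section Frames.
Context {R : realType} {p q k : nat}.
Local Notation C := (R[i]).
Local Notation n := (p + q)%N.
Implicit Types (t : GPL R p q k).

Lemma memV1 (w : 'cV[C]_n) : (w \in V1 R p q) = (dsubmx w == 0).
Proof.
apply/memv_imxP/eqP => [[u ->]|w0].
  by rewrite mul_col_mx col_mxKd mul0mx.
by exists (usubmx w); rewrite mul_col_mx mul1mx mul0mx -w0 vsubmxK.
Qed.

Lemma frame_rank (A : 'M[C]_(n, k)) v t : frame A v t -> \rank A = k.
Proof. by case=> AW _; rewrite -dim_imx AW; exact/eqP/(valP t.1.1). Qed.

Lemma frame_col (A : 'M[C]_(n, k)) v t : frame A v t ->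
  [/\ v = col_mx (usubmx v) 0, v != 0 & usubmx v != 0].
Proof.
case=> _ vL; case/andP: (valP t.1.2); rewrite -[val t.1.2]vL dim_vline => v0 LV.
have : v \in V1 R p q by apply: (subvP LV); exact: memv_line.
rewrite memV1 => /eqP vd.
have vE : v = col_mx (usubmx v) 0 by rewrite -[0]vd vsubmxK.
have vn0 : v != 0 by case: (v != 0) v0.
by split=> //; apply: contra vn0 => /eqP u0; rewrite vE u0 col_mx0.
Qed.

Lemma frame_exists t : exists A v, frame A v t.
Proof.
have [A [AW _]] := vspace_frame (eqP (valP t.1.1)).
case/andP: (valP t.1.2) => /eqP /vspace_frame[v [vL _]] _.
by exists A, v; split => //; rewrite vline_imx.
Qed.

Lemma frame_build (A : 'M[C]_(n, k)) (v : 'cV[C]_p) (x : 'M[C]_n) :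
  \rank A = k -> v != 0 ->
  exists2 t : GPL R p q k, frame A (col_mx v 0) t & endx t = x.
Proof.
move=> rA v0.
have dW : \dim (imx A) == k by rewrite dim_imx rA.
have dL : (\dim <[col_mx v 0 : 'cV[C]_n]> == 1)%N && (<[col_mx v 0]> <= V1 R p q)%VS.
  rewrite dim_vline col_mx_eq0 negb_and v0 /= -memvE memV1.
  by rewrite col_mxKd eqxx.
pose W : Gr R k n := exist (fun W : {vspace 'cV[C]_n} => \dim W == k) _ dW.
pose L : PV1 R p q := exist (fun L : {vspace 'cV[C]_n} =>
  (\dim L == 1)%N && (L <= V1 R p q)%VS) _ dL.
by exists (W, L, x).
Qed.

Lemma frame_change (A A' : 'M[C]_(n, k)) v v' t :
  frame A v t -> frame A' v' t ->
  (exists2 h, h \in unitmx & A' = A *m h) /\ (exists2 c, c != 0 & v' = c *: v).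
Proof.
move=> fr fr'; have rA := frame_rank fr; have rA' := frame_rank fr'.
have [_ v0 _] := frame_col fr'.
case: fr fr' => AW vL [AW' vL']; split.
  have /imx_subP[h hE] : (imx A' <= imx A)%VS by rewrite AW AW'.
  exists h => //; rewrite -row_full_unit /row_full eqn_leq rank_leq_col /=.
  by rewrite -[X in (X <= _)%N]rA' hE mxrankM_maxr.
have /vlineP[c cE] : v' \in <[v]>%VS by rewrite vL -vL' memv_line.
by exists c => //; apply: contra v0 => /eqP c0; rewrite cE c0 scale0r.
Qed.

(** Since Im x^θ < L < V1, the lower right block of x vanishes and the upper left one is a multiple
    [v *m phi] of v. *)
Lemma conormal_frameP (A1 : 'M[C]_(p, k)) (A2 : 'M[C]_(q, k)) (v : 'cV[C]_p) t :
  frame (col_mx A1 A2) (col_mx v 0) t ->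
  conormal k t <-> exists phi X Y,
    endx t = block_mx (v *m phi) X Y 0 /\ conormal_fibre A1 A2 v phi X Y.
Proof.
move=> fr; have [_ _] := frame_col fr; rewrite col_mxKu => v0.
case: (fr) => AW vL; rewrite /conormal /= -AW -vL vline_imx; split.
  case=> /imx_subP[y xE] /imx_sub_kerxP xA /imx_subP[Z tE] /imx_sub_kerxP tv.
  move: xE xA tE tv; rewrite -[endx t]submxK /theta.
  rewrite !block_mxKul !block_mxKdr.
  move: (ulsubmx _) (ursubmx _) (dlsubmx _) (drsubmx _) => a X Y d.
  rewrite -[y]hsubmxK -[Z]hsubmxK !mul_col_row.
  move: (lsubmx y) (rsubmx y) (lsubmx Z) (rsubmx Z) => y1 y2 phi psi.
  move=> /eq_block_mx[aE XE YE dE] xA /eq_block_mx[aE' _ _ dE'] tv.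
  rewrite mul0mx in dE'; exists phi, X, Y; rewrite -aE' dE'; split=> //.
  move: xA tv; rewrite !mul_block_col !mul0mx !mulmx0 !addr0.
  move/eqP; rewrite col_mx_eq0 => /andP[/eqP E1 /eqP].
  rewrite dE' mul0mx addr0 => E2 /eqP; rewrite col_mx_eq0 => /andP[/eqP av _].
  split.
  - by rewrite -aE'.
  - by [].
  (* Cancelling v on the left of [v *m phi *m v = 0]. *)
  - have [w wv] := col_neq0_retraction v0.
    by rewrite -[LHS]mul1mx -wv -mulmxA [v *m _]mulmxA -aE' av mulmx0.
  - by exists y1, y2; split=> //; [rewrite -aE' | rewrite -dE].
case=> phi [X [Y [xE [E1 E2 pv [y1 [y2 [aE XE YE dE]]]]]]].
rewrite xE /theta block_mxKul block_mxKdr; split.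
- apply/imx_subP; exists (row_mx y1 y2).
  by rewrite mul_col_row aE -XE -YE dE.
- apply/imx_sub_kerxP; rewrite mul_block_col E1 E2 mul0mx addr0.
  by rewrite col_mx0.
- apply/imx_subP; exists (row_mx phi 0).
  by rewrite mul_col_row !mulmx0 !mul0mx.
- apply/imx_sub_kerxP; rewrite mul_block_col !mul0mx !addr0.
  by rewrite -mulmxA pv mulmx0 col_mx0.
Qed.

End Frames.

(* A matrix depending polynomially on (A, v, x), which is what naturality in the
   ring provides, and whose rank does not depend on the frame (A, v) of
   (W, L). *)
Record covariant_mx (p q k m1 m2 : nat) := CovariantMx {
  cov_mx :> forall S : comNzRingType, 'M[S]_(p + q, k) -> 'cV[S]_(p + q) ->
    'M[S]_(p + q) -> 'M[S]_(m1, m2);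
  cov_natural : forall (S S' : comNzRingType) (f : {rmorphism S -> S'}) A v x,
    map_mx f (cov_mx A v x) = cov_mx (map_mx f A) (map_mx f v) (map_mx f x);
  cov_frame : forall (F : fieldType) (A : 'M[F]_(p + q, k)) v x h c,
    h \in unitmx -> c != 0 ->
    \rank (cov_mx (A *m h) (c *: v) x) = \rank (cov_mx A v x) }.

(** * Rank loci and rational curves in the Zariski topology *)

Section Polynomials.
Context {R : realType} {p q k : nat}.
Local Notation C := (R[i]).
Local Notation n := (p + q)%N.
Local Notation N := (n * k + (n + n * n))%N.
Local Notation GPL := (GPL R p q k).

Section RankLocus.
Variables (m1 m2 : nat) (Phi : covariant_mx p q k m1 m2).

Definition rank_below r : set GPL :=
  [set t | exists A v, frame A v t /\ (\rank (Phi _ A v (endx t)) < r)%N].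

Lemma rank_belowE r (t : GPL) A v :
  frame A v t -> rank_below r t <-> (\rank (Phi _ A v (endx t)) < r)%N.
Proof.
move=> fr; split=> [[A' [v' [fr']]]|rP]; last by exists A, v.
have [[h uh ->] [c c0 ->]] := frame_change fr fr'.
by rewrite cov_frame.
Qed.

(** The entries of the universal triple (A, v, x) are the coordinate variables; by [cov_natural],
    evaluating [Phi] there and then specializing gives [Phi] at any point. *)
Let gA : 'M[{mpoly C[N]}]_(n, k) :=
  \matrix_(i, j) 'X_(lshift _ (mxvec_index i j)).
Let gv : 'cV[{mpoly C[N]}]_n :=
  \col_i 'X_(rshift _ (lshift _ i)).
Let gx : 'M[{mpoly C[N]}]_n :=
  \matrix_(i, j) 'X_(rshift _ (rshift _ (mxvec_index i j))).

Lemma meval_coords (S : 'M[C]_(n, k)) (v : 'cV[C]_n) (x : 'M[C]_n) :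
  let f := meval (coords S v x) in
  [/\ map_mx f gA = S, map_mx f gv = v & map_mx f gx = x].
Proof.
split; apply/matrixP => i j; rewrite !mxE mevalXU /coords.
- by rewrite row_mxEl mxvecE.
- by rewrite row_mxEr row_mxEl mxE ord1.
- by rewrite !row_mxEr mxvecE.
Qed.

Lemma rank_below_closed r : closed (rank_below r).
Proof.
case: r => [|r].
  suff -> : rank_below 0 = set0 by exact: closed0.
  by rewrite -subset0 => t [A [v []]].
apply/closed_zclosed.
pose lift m1 m2 (B : 'M[C]_(m1, m2)) : 'M[{mpoly C[N]}]_(m1, m2) :=
  map_mx (@mpolyC N C) B.
exists [set f | exists (L : 'M[C]_(r.+1, m1)) (D : 'M[C]_(m2, r.+1)),
  f = \det (lift _ _ L *m Phi _ gA gv gx *m lift _ _ D)] => t A v fr.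
have evalE (L : 'M[C]_(r.+1, m1)) (D : 'M[C]_(m2, r.+1)) :
    (\det (lift _ _ L *m Phi _ gA gv gx *m lift _ _ D)).@[coords A v (endx t)] =
    \det (L *m Phi _ A v (endx t) *m D).
  have [eA ev ex] := meval_coords A v (endx t).
  have liftK l1 l2 (B : 'M[C]_(l1, l2)) :
      map_mx (meval (coords A v (endx t))) (lift _ _ B) = B.
    by apply/matrixP => i j; rewrite !mxE mevalC.
  rewrite -det_map_mx !map_mxM !liftK cov_natural.
  by congr (\det (_ *m Phi _ _ _ _ *m _)).
rewrite (rank_belowE _ fr) ltnS rank_minorsP; split=> [h f [L [D ->]]|h L D].
  by rewrite evalE h.
by rewrite -evalE; apply: h; exists L, D.
Qed.

End RankLocus.

Definition curve_at m1 m2 (A : 'M[{poly C}]_(m1, m2)) (s : C) : 'M[C]_(m1, m2) :=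
  map_mx (horner_eval s) A.

Lemma coords_curve (A : 'M[{poly C}]_(n, k)) (v : 'cV[{poly C}]_n)
    (x : 'M[{poly C}]_n) (f : {mpoly C[N]}) :
  exists P : {poly C}, forall s,
    P.[s] = f.@[coords (curve_at A s) (curve_at v s) (curve_at x s)].
Proof.
pose h (i : 'I_N) : {poly C} := row_mx (mxvec A) (row_mx v^T (mxvec x)) 0 i.
exists (\sum_(m <- msupp f) f@_m *: \prod_i h i ^+ m i) => s.
rewrite mevalE horner_sum; apply: eq_bigr => m _; rewrite hornerZ horner_prod.
congr (_ * _); apply: eq_bigr => i _; rewrite horner_exp; congr (_ ^+ _).
rewrite /coords /curve_at -!map_mxvec map_trmx -!map_row_mx mxE.
by rewrite /horner_eval.
Qed.

Lemma poly_nonroot (P : {poly C}) : P != 0 -> exists s, P.[s] != 0.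
Proof.
move=> P0; pose rs : seq C := [seq i%:R | i <- iota 0 (size P)].
(* The naturals below [size P] are distinct in characteristic 0, and too many to be all roots. *)
have : ~~ all (root P) rs.
  apply/negP => /(max_poly_roots P0).
  rewrite map_inj_uniq ?iota_uniq; last first.
    by move=> i j /eqP; rewrite eqr_nat => /eqP.
  by rewrite size_map size_iota ltnn => /(_ isT).
by case/allPn => s _; exists s.
Qed.

(* If T were covered by F and G but contained in neither, a curve through a point
   off F and a point off G would leave both. *)
Lemma curve_irreducible (T : set GPL) : T !=set0 ->
  (forall t0 t1, T t0 -> T t1 ->
     exists A v x (d : {poly C}), [/\ d.[0] != 0, d.[1] != 0,
       frame (curve_at A 0) (curve_at v 0) t0 /\ endx t0 = curve_at x 0,
       frame (curve_at A 1) (curve_at v 1) t1 /\ endx t1 = curve_at x 1 &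
       forall s, d.[s] != 0 ->
         exists t, [/\ T t, frame (curve_at A s) (curve_at v s) t &
                       endx t = curve_at x s]]) ->
  irreducible T.
Proof.
move=> T0 Tc; split=> // F G /closed_zclosed[SF hF] /closed_zclosed[SG hG] TFG.
apply: contrapT => /not_orP[/existsNP[t0 /not_implyP[Tt0 nF]]
                           /existsNP[t1 /not_implyP[Tt1 nG]]].
have [A [v [x [d [d0 d1 [fr0 x0] [fr1 x1] Ts]]]]] := Tc _ _ Tt0 Tt1.
have [f [Sf fN0]] : exists f, SF f /\ f.@[coords (curve_at A 0) (curve_at v 0) (endx t0)] != 0.
  apply: contrapT => nf; apply: nF; apply/(hF _ _ _ fr0) => f Sf.
  by apply/eqP; apply: contrapT => /negP fN; apply: nf; exists f.
have [g [Sg gN0]] : exists g, SG g /\ g.@[coords (curve_at A 1) (curve_at v 1) (endx t1)] != 0.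
  apply: contrapT => nf; apply: nG; apply/(hG _ _ _ fr1) => f' Sf'.
  by apply/eqP; apply: contrapT => /negP fN; apply: nf; exists f'.
have [P PE] := coords_curve A v x f.
have [Q QE] := coords_curve A v x g.
rewrite x0 -PE in fN0; rewrite x1 -QE in gN0.
have neq0 (U : {poly C}) s : U.[s] != 0 -> U != 0.
  by apply: contra => /eqP ->; rewrite horner0.
have : d * P * Q != 0 by rewrite !mulf_neq0 ?(neq0 _ _ d0) ?(neq0 _ _ fN0) ?(neq0 _ _ gN0).
case/poly_nonroot => s; rewrite !hornerM !mulf_eq0 !negb_or -andbA.
case/and3P => ds Ps Qs; have [t [Tt frt xt]] := Ts s ds.
case: (TFG t Tt) => [/(hF _ _ _ frt)/(_ f Sf)|/(hG _ _ _ frt)/(_ g Sg)].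
  by rewrite xt -PE => /eqP; rewrite (negPf Ps).
by rewrite xt -QE => /eqP; rewrite (negPf Qs).
Qed.

End Polynomials.

(** * Conormal bundles *)

Section Strata.
Context {R : realType} {p q k : nat}.
Local Notation C := (R[i]).
Local Notation n := (p + q)%N.
Local Notation GPL := (GPL R p q k).

Definition stratum (a b j : nat) : set GPL :=
  [set t | exists A1 A2 v,
     [/\ frame (col_mx A1 A2) (col_mx v 0) t, pair_type a b j A1 A2 v &
         in_fibre A1 A2 v (endx t)]].

Lemma stratum_conormal a b j t : stratum a b j t -> conormal k t.
Proof.
move=> [A1 [A2 [v [fr _ [phi [X [Y xE]]]]]]].
by apply/(conormal_frameP fr); exists phi, X, Y.
Qed.

Lemma stratum_build a b j (A1 : 'M[C]_(p, k)) (A2 : 'M[C]_(q, k)) v x :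
  pair_type a b j A1 A2 v -> in_fibre A1 A2 v x ->
  exists t, [/\ stratum a b j t, frame (col_mx A1 A2) (col_mx v 0) t &
    endx t = x].
Proof.
move=> tA fx; case: (tA) => _ _ rA v0 _.
have [t fr tx] := frame_build x rA v0.
by exists t; split=> //; exists A1, A2, v; rewrite tx.
Qed.

Lemma conormal_stratum t : conormal k t ->
  exists a b j, admissible p q k a b j /\ stratum a b j t.
Proof.
have [A [v fr]] := frame_exists t; have rA := frame_rank fr.
have [vE v0 u0] := frame_col fr.
move: fr rA; rewrite -[A]vsubmxK vE => fr rA /(conormal_frameP fr) fx.
have [a [b [j [tA adm]]]] := pair_type_exists rA u0.
by exists a, b, j; split=> //; exists (usubmx A), (dsubmx A), (usubmx v).
Qed.

Lemma curve_atM m1 m2 m3 (A : 'M[{poly C}]_(m1, m2)) (B : 'M[{poly C}]_(m2, m3)) s :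
  curve_at (A *m B) s = curve_at A s *m curve_at B s.
Proof. exact: map_mxM. Qed.

Lemma curve_atC m1 m2 (A : 'M[C]_(m1, m2)) s :
  curve_at (map_mx polyC A) s = A.
Proof. by apply/matrixP => i j; rewrite !mxE /horner_eval hornerC. Qed.

Definition segment m1 m2 (A B : 'M[C]_(m1, m2)) : 'M[{poly C}]_(m1, m2) :=
  map_mx polyC A + 'X *: map_mx polyC (B - A).

Lemma curve_at_segment m1 m2 (A B : 'M[C]_(m1, m2)) s :
  curve_at (segment A B) s = A + s *: (B - A).
Proof.
apply/matrixP => i j; rewrite !mxE /horner_eval hornerD hornerM hornerX.
by rewrite !hornerC.
Qed.

Lemma horner_det m (A : 'M[{poly C}]_m) s :
  (\det A).[s] = \det (curve_at A s).
Proof. by rewrite /curve_at det_map_mx. Qed.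

Lemma curve_at_adj m (A : 'M[{poly C}]_m) s :
  curve_at (\adj A) s = \adj (curve_at A s).
Proof. by rewrite /curve_at map_mx_adj. Qed.

Lemma adjE m (A : 'M[C]_m) : A \in unitmx -> \adj A = \det A *: invmx A.
Proof.
move=> uA; by rewrite /invmx uA scalerA divrr ?scale1r -?unitmxE.
Qed.

Lemma diag_segment (g1 : 'M[C]_p) (g2 : 'M[C]_q) s :
  curve_at (segment 1%:M (block_mx g1 0 0 g2)) s =
  block_mx (1%:M + s *: (g1 - 1%:M)) 0 0 (1%:M + s *: (g2 - 1%:M)).
Proof.
rewrite curve_at_segment scalar_mx_block opp_block_mx add_block_mx.
by rewrite scale_block_mx add_block_mx !oppr0 !addr0 !scaler0 !addr0.
Qed.

(* The curve s |-> (g_s W, g_s L, g_s y_s adj(g_s)) with g_s = 1 + s (g - 1)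
   joins any two points of a stratum; the adjugate, instead of the inverse,
   keeps it polynomial, and the factor det(g_s) is absorbed by the linear
   fibre. *)
Lemma stratum_irreducible a b j :
  admissible p q k a b j -> irreducible (stratum a b j).
Proof.
move=> adm; apply: curve_irreducible.
  have [A1 [A2 [v [phi [X [Y [tA fA _]]]]]]] := @generic_exists C _ _ _ _ _ _ adm.
  have [|t [st _ _]] := stratum_build tA (x := block_mx (v *m phi) X Y 0).
    by exists phi, X, Y.
  by exists t.
move=> t0 t1 [A1 [A2 [v [fr0 tA f0]]]] [B1 [B2 [w [fr1 tB f1]]]].
have [g1 [g2 [h [[u1 u2 uh] gA1 gA2 gv]]]] := pair_type_transitive tA tB.
pose g := block_mx g1 0 0 g2.
have ug : g \in unitmx by rewrite block_diag_mx_unit u1 u2.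
(* The translate by g of the frame of t0 is a frame of t1: h only changes the basis of W. *)
have fr1' : frame (col_mx (g1 *m A1) (g2 *m A2)) (col_mx (g1 *m v) 0) t1.
  case: fr1 => BW wL; split; last by rewrite gv.
  rewrite -BW gA1 gA2 -mul_col_mx; apply: imx_eqP; apply/imx_subP.
    by exists h.
  by exists (invmx h); rewrite mulmxK.
have f1' : in_fibre (g1 *m A1) (g2 *m A2) (g1 *m v) (endx t1).
  apply/(conormal_frameP fr1'); apply: (@stratum_conormal a b j).
  by exists B1, B2, w.
have f1'' : in_fibre A1 A2 v (invmx g *m endx t1 *m g).
  have := in_fibre_act (g1 := invmx g1) (g2 := invmx g2) _ _ f1'.
  rewrite !unitmx_inv !mulKmx // => /(_ u1 u2).
  by rewrite -invmx_block_diag // invmxK.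
(* At s = 1 the adjugate contributes a factor [\det g], which [y1] cancels in advance. *)
pose x0 := endx t0; pose y1 := (\det g)^-1 *: (invmx g *m endx t1 *m g).
pose G := segment 1%:M g.
pose x := G *m segment x0 y1 *m \adj G.
have G0 : curve_at G 0 = 1%:M by rewrite curve_at_segment scale0r addr0.
have G1 : curve_at G 1 = g by rewrite curve_at_segment scale1r addrC subrK.
have dg : \det g != 0 by move: ug; rewrite unitmxE unitfE.
exists (G *m map_mx polyC (col_mx A1 A2)), (G *m map_mx polyC (col_mx v 0)), x.
exists (\det G); split.
- by rewrite horner_det G0 det1 oner_eq0.
- by rewrite horner_det G1.
- rewrite !curve_atM !curve_atC curve_at_adj G0 !mul1mx; split=> //.
  by rewrite curve_at_segment scale0r addr0 adj1 mulmx1.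
- rewrite !curve_atM !curve_atC curve_at_adj G1 !mul_diag_col mulmx0; split=> //.
  rewrite curve_at_segment scale1r addrC subrK /y1 adjE //.
  rewrite -2!scalemxAr -scalemxAl scalerA divff // scale1r.
  by rewrite !mulmxA mulmxV // mul1mx -mulmxA mulmxV // mulmx1.
- move=> s; rewrite horner_det !curve_atM !curve_atC curve_at_adj.
  rewrite /G diag_segment => ds.
  move: (1%:M + s *: (g1 - 1%:M)) (1%:M + s *: (g2 - 1%:M)) ds => h1 h2 ds.
  have uH : block_mx h1 0 0 h2 \in unitmx by rewrite unitmxE unitfE.
  have := uH; rewrite block_diag_mx_unit => /andP[uh1 uh2].
  rewrite !mul_diag_col mulmx0 adjE // -scalemxAr.
  apply: stratum_build; first exact: pair_type_act.
  apply: in_fibreZ; apply: in_fibre_act => //; rewrite curve_at_segment.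
  apply: in_fibreD => //; apply/in_fibreZ/in_fibreD; first exact: in_fibreZ.
  by rewrite -scaleN1r; apply: in_fibreZ.
Qed.

End Strata.

(** * Matrices whose ranks are used as closed conditions *)

Section CovariantMatrices.
Variables (p q k : nat).
Local Notation n := (p + q)%N.

Lemma usubmxZ (F : fieldType) m1 m2 l c (A : 'M[F]_(m1 + m2, l)) :
  usubmx (c *: A) = c *: usubmx A.
Proof. by apply/matrixP => i j; rewrite !mxE. Qed.

Lemma rank_row_mx_frame (F : fieldType) m l (A : 'M[F]_(m, l)) (v : 'cV[F]_m) h c :
  h \in unitmx -> c != 0 -> \rank (row_mx (A *m h) (c *: v)) = \rank (row_mx A v).
Proof.
move=> uh c0.
have -> : row_mx (A *m h) (c *: v) = row_mx A v *m block_mx h 0 0 c%:M.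
  by rewrite mul_row_block !mulmx0 addr0 add0r mul_mx_scalar.
by rewrite mxrank_unitr // block_diag_mx_unit uh unitmxE det_scalar1 unitfE.
Qed.

(** [cov_A1] and [cov_A2] detect dim W∩V2 and dim W∩V1, [cov_Av] and [cov_A1v] the inclusion of L in
    W and in W + V2; the others concern x and its position relative to L and W. *)
Definition cov_A1 : covariant_mx p q k p k.
Proof.
exists (fun S A v x => usubmx A) => [S S' f A v x|F A v x h c uh c0].
  by rewrite map_usubmx.
by rewrite -mul_usub_mx mxrank_unitr.
Defined.

Definition cov_A2 : covariant_mx p q k q k.
Proof.
exists (fun S A v x => dsubmx A) => [S S' f A v x|F A v x h c uh c0].
  by rewrite map_dsubmx.
by rewrite -mul_dsub_mx mxrank_unitr.
Defined.

Definition cov_Av : covariant_mx p q k n (k + 1).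
Proof.
exists (fun S A v x => row_mx A v) => [S S' f A v x|F A v x h c uh c0].
  by rewrite map_row_mx.
exact: rank_row_mx_frame.
Defined.

Definition cov_A1v : covariant_mx p q k p (k + 1).
Proof.
exists (fun S A v x => row_mx (usubmx A) (usubmx v))
  => [S S' f A v x|F A v x h c uh c0].
  by rewrite map_row_mx !map_usubmx.
by rewrite -mul_usub_mx usubmxZ rank_row_mx_frame.
Defined.

Definition cov_X : covariant_mx p q k p q.
Proof.
exists (fun S A v x => ursubmx x) => [S S' f A v x|//].
by rewrite map_ursubmx.
Defined.

Definition cov_Y : covariant_mx p q k q p.
Proof.
exists (fun S A v x => dlsubmx x) => [S S' f A v x|//].
by rewrite map_dlsubmx.
Defined.

Definition cov_Xv : covariant_mx p q k p (q + 1).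
Proof.
exists (fun S A v x => row_mx (ursubmx x) (usubmx v))
  => [S S' f A v x|F A v x h c uh c0].
  by rewrite map_row_mx map_ursubmx map_usubmx.
by rewrite usubmxZ -{1}[ursubmx x]mulmx1 rank_row_mx_frame // unitmx1.
Defined.

Definition cov_Yv : covariant_mx p q k q 1.
Proof.
exists (fun S A v x => dlsubmx x *m usubmx v)
  => [S S' f A v x|F A v x h c uh c0].
  by rewrite map_mxM map_dlsubmx map_usubmx.
by rewrite usubmxZ -scalemxAr mxrank_scale_nz.
Defined.

Definition cov_x1 : covariant_mx p q k p p.
Proof.
exists (fun S A v x => ulsubmx x) => [S S' f A v x|//].
by rewrite map_ulsubmx.
Defined.

Definition cov_x1A1 : covariant_mx p q k p k.
Proof.
exists (fun S A v x => ulsubmx x *m usubmx A)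
  => [S S' f A v x|F A v x h c uh c0].
  by rewrite map_mxM map_ulsubmx map_usubmx.
by rewrite -mul_usub_mx mulmxA mxrank_unitr.
Defined.

Definition cov_Yx1 : covariant_mx p q k (q + p) p.
Proof.
exists (fun S A v x => col_mx (dlsubmx x) (ulsubmx x)) => [S S' f A v x|//].
by rewrite map_col_mx map_dlsubmx map_ulsubmx.
Defined.

End CovariantMatrices.

(** * No conormal bundle lies in the closure of another *)

Section Closures.
Context {R : realType} {p q k : nat}.
Local Notation C := (R[i]).
Local Notation n := (p + q)%N.
Local Notation GPL := (GPL R p q k).

Lemma stratum_closure_rank m1 m2 (Phi : covariant_mx p q k m1 m2) r a b j
    (S : set GPL) :
  (forall (A1 : 'M[C]_(p, k)) (A2 : 'M[C]_(q, k)) v phi X Y,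
     pair_type a b j A1 A2 v -> conormal_fibre A1 A2 v phi X Y ->
     (\rank (Phi _ (col_mx A1 A2) (col_mx v 0%R) (block_mx (v *m phi) X Y 0)) <= r)%N) ->
  S `<=` closure (stratum a b j) ->
  forall t A v, S t -> frame A v t -> (\rank (Phi _ A v (endx t)) <= r)%N.
Proof.
move=> bnd St t A v /St; rewrite /closure /= => clt fr.
rewrite -ltnS; apply/(rank_belowE Phi r.+1 fr); apply: contrapT => nt.
have [|u [[A1 [A2 [w [fru tA [phi [X [Y [xE fA]]]]]]]] nu]] :=
    clt (~` rank_below Phi r.+1).
  by apply: open_nbhs_nbhs; split => //; apply/closed_openC/rank_below_closed.
by apply: nu; apply/(rank_belowE _ _ fru); rewrite xE ltnS; exact: bnd.
Qed.

(** [gen_r] is the minimum of the two bounds a and q + a - k + [j = 0 and a + b < k]; comparing k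
    with q tells which one is smaller. [gen_s] arises likewise from b + [j = 1] and p + b - k. *)
Lemma rank_X_le_gen (F : fieldType) a b j (A1 : 'M[F]_(p, k)) (A2 : 'M[F]_(q, k)) v phi X Y :
  pair_type a b j A1 A2 v -> conormal_fibre A1 A2 v phi X Y ->
  (\rank X <= gen_r q k a b j)%N.
Proof.
move=> tA fA; have := rank_X_le_a tA fA; have := rank_X_le tA fA.
by rewrite /gen_r; case: ifP; lia.
Qed.

Lemma rank_Y_le_gen (F : fieldType) a b j (A1 : 'M[F]_(p, k)) (A2 : 'M[F]_(q, k)) v phi X Y :
  pair_type a b j A1 A2 v -> conormal_fibre A1 A2 v phi X Y ->
  (\rank Y <= gen_s p k b j)%N.
Proof.
move=> tA fA; have := rank_Y_le_p tA fA; have := rank_Y_le tA fA.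
by rewrite /gen_s; case: ifP; lia.
Qed.

Lemma col_row_neq0 (F : fieldType) m l (v : 'cV[F]_m) (w : 'rV[F]_l) :
  v != 0 -> w != 0 -> v *m w != 0.
Proof.
move=> /col_neq0_retraction[u uv]; apply: contra => /eqP vw.
by rewrite -[w]mul1mx -uv -mulmxA vw mulmx0.
Qed.

Lemma stratum_incl a b j a' b' j' :
  admissible p q k a b j -> admissible p q k a' b' j' ->
  stratum a b j `<=` closure (stratum a' b' j' : set GPL) ->
  (a, b, j) = (a', b', j').
Proof.
move=> adm adm' incl.
have [A1 [A2 [v [phi [X [Y [tA fA [rX rY gX gY [gphi gpA gYx]]]]]]]]] :=
  @generic_exists C _ _ _ _ _ _ adm.
have [|t [st fr tx]] := stratum_build tA (x := block_mx (v *m phi) X Y 0).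
  by exists phi, X, Y.
(* A rank bound valid on the whole bundle of type (a', b', j') passes to the generic point of the
   other one. *)
have tr m1 m2 (Phi : covariant_mx p q k m1 m2) r
    (bnd : forall (B1 : 'M[C]_(p, k)) (B2 : 'M[C]_(q, k)) w psi X' Y',
      pair_type a' b' j' B1 B2 w -> conormal_fibre B1 B2 w psi X' Y' ->
      (\rank (Phi _ (col_mx B1 B2) (col_mx w 0%R)
                    (block_mx (w *m psi) X' Y' 0)) <= r)%N) :
    (\rank (Phi _ (col_mx A1 A2) (col_mx v 0%R) (block_mx (v *m phi) X Y 0)) <= r)%N.
  by rewrite -tx; exact: (stratum_closure_rank bnd incl st fr).
case: (tA) => rA1 rA2 rA12 v0 jv.
have aa : (a' <= a)%N.
  have := tr _ _ (cov_A2 p q k) (k - a')%N; rewrite /= !col_mxKd => h.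
  suff : (\rank A2 <= k - a')%N by case/and5P: adm'; lia.
  by apply: h => B1 B2 w psi X' Y' [? ? ? ? ?] _; rewrite col_mxKd; lia.
have bb : (b' <= b)%N.
  have := tr _ _ (cov_A1 p q k) (k - b')%N; rewrite /= !col_mxKu => h.
  suff : (\rank A1 <= k - b')%N by case/and5P: adm'; lia.
  by apply: h => B1 B2 w psi X' Y' [? ? ? ? ?] _; rewrite col_mxKu; lia.
have rr : (gen_r q k a b j <= gen_r q k a' b' j')%N.
  have := tr _ _ (cov_X p q k) (gen_r q k a' b' j'); rewrite /= block_mxKur rX.
  apply=> B1 B2 w psi X' Y' tB fB; rewrite block_mxKur.
  exact: rank_X_le_gen tB fB.
have ss : (gen_s p k b j <= gen_s p k b' j')%N.
  have := tr _ _ (cov_Y p q k) (gen_s p k b' j'); rewrite /= block_mxKdl rY.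
  apply=> B1 B2 w psi X' Y' tB fB; rewrite block_mxKdl.
  exact: rank_Y_le_gen tB fB.
have Av : j' = 0%N -> j = 0%N.
  move=> j0; have := tr _ _ (cov_Av p q k) k; rewrite /= => h.
  have /rank_row_mxP[u] : (\rank (row_mx (col_mx A1 A2) (col_mx v 0)) <=
      \rank (col_mx A1 A2))%N.
    rewrite rA12; apply: h => B1 B2 w psi X' Y' [_ _ rB _]; rewrite j0.
    case=> u [wu Bu] _; rewrite -[X in (_ <= X)%N]rB; apply/rank_row_mxP.
    by exists u; rewrite mul_col_mx -wu Bu.
  rewrite mul_col_mx => /eq_col_mx[vu Au].
  case: (j) jv => // -[[_ []]|m []]; last by exists u.
  by exists u.
have A1v : (j' <= 1)%N -> b = b' -> (j <= 1)%N.
  move=> j1 bE; have := tr _ _ (cov_A1v p q k) (k - b')%N; rewrite /= !col_mxKu => h.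
  have /rank_row_mxP[u vu] : (\rank (row_mx A1 v) <= \rank A1)%N.
    suff : (\rank (row_mx A1 v) <= k - b')%N by lia.
    apply: h => B1 B2 w psi X' Y' [rB1 _ _ _ jw] _; rewrite !col_mxKu.
    suff : (\rank (row_mx B1 w) <= \rank B1)%N by lia.
    apply/rank_row_mxP.
    case: (j') j1 jw => [_ [u [-> _]]|[_ [[u ->] _]|//]]; by exists u.
  by case: (j) jv => // -[//|m []]; exists u.
have Yv : (j' <= 1)%N -> Y *m v = 0.
  move=> j1; have := tr _ _ (cov_Yv p q k) 0%N; rewrite /= block_mxKdl col_mxKu.
  move=> h; apply/eqP; rewrite -mxrank_eq0 -leqn0; apply: h.
  move=> B1 B2 w psi X' Y' tB fB; rewrite block_mxKdl col_mxKu.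
  by rewrite (Yv_eq0 tB fB) ?mxrank0.
have Xv : j' = 0%N -> (\rank (row_mx X v) <= q + a' + 1 - k)%N.
  move=> j0; have := tr _ _ (cov_Xv p q k) (q + a' + 1 - k)%N.
  rewrite /= block_mxKur col_mxKu; apply.
  move=> B1 B2 w psi X' Y' tB fB; rewrite block_mxKur col_mxKu.
  by have [_ h] := rank_Xv_le tB fB j0; rewrite -(leq_add2r k) (leq_trans h) //; lia.
have x1 : (1 < j')%N -> (k < p + b)%N -> (j <= 1)%N -> False.
  move=> j1 kpb jj; have := tr _ _ (cov_x1 p q k) 0%N; rewrite /= block_mxKul.
  rewrite leqn0 mxrank_eq0 (negPf (col_row_neq0 v0 (gphi jj kpb))) => h.
  have // : false; apply: h => B1 B2 w psi X' Y' tB fB; rewrite block_mxKul.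
  by rewrite (phi_eq0 tB fB j1) mulmx0 mxrank0.
have x1A1 : (0 < j')%N -> j = 0%N -> (a + b < k)%N -> False.
  move=> j1 jj ab; have := tr _ _ (cov_x1A1 p q k) 0%N.
  rewrite /= block_mxKul col_mxKu -mulmxA leqn0 mxrank_eq0.
  rewrite (negPf (col_row_neq0 v0 (gpA jj ab))) => h.
  have // : false; apply: h => B1 B2 w psi X' Y' tB fB.
  rewrite block_mxKul col_mxKu -mulmxA (phiA1_eq0 tB fB) ?mulmx0 ?mxrank0 //.
  by rewrite -lt0n j1.
have Yx1 : (j' <= 1)%N -> (\rank (col_mx Y (v *m phi)) <= b' + 1)%N.
  move=> j1; have := tr _ _ (cov_Yx1 p q k) (b' + 1)%N.
  rewrite /= block_mxKul block_mxKdl; apply.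
  move=> B1 B2 w psi X' Y' tB fB; rewrite block_mxKul block_mxKdl.
  exact: rank_vphi_Y tB fB j1.
case/and5P: adm adm' => abk kpb kqa j3 _ /and5P[abk' kpb' kqa' j3' hj'].
case: j' Av A1v Yv Xv x1 x1A1 Yx1 rr ss j3' hj' {tr incl}
  => [|[|[|//]]] Av A1v Yv Xv x1 x1A1 Yx1 rr ss _ hj'.
- have j0 := Av erefl; subst j; move: rr ss; rewrite /gen_r /gen_s /=.
  have nXv : (q < k)%N -> (a + b)%N = k -> (\rank (row_mx X v) = (\rank X).+1).
    by move=> qk ab; apply/rank_row_mx_notin/gX.
  have := Xv erefl; move: nXv; rewrite rX /gen_r.
  case: (leqP k q) => kq /= nXv Xv' rr; case: ifP => kp ss.
  + have -> : a = a' by lia.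
    by have -> : b = b' by lia.
  + have -> : a = a' by lia.
    by have -> : b = b' by lia.
  (* For q < k and a + b = k the rank of X only yields a <= a' + 1. In that case v is generically
     outside Im X, and the rank of [row_mx X v] removes the unit. *)
  + have bE : b = b' by lia.
    rewrite bE; have -> // : a = a'.
    have [|] := leqP k (a + b)%N; last by lia.
    by move=> abk''; have := nXv isT ltac:(lia); lia.
  + have bE : b = b' by lia.
    rewrite bE; have -> // : a = a'.
    have [|] := leqP k (a + b)%N; last by lia.
    by move=> abk''; have := nXv isT ltac:(lia); lia.
- have aE : a = a' by move: rr; rewrite /gen_r /=; case: ifP; lia.
  have [bE|bE] := eqVneq b b'.
    have j1 := A1v isT bE; rewrite aE bE.
    case: (j) j1 x1A1 => [_ x1A1|[//|//]].
    by exfalso; apply: x1A1 => //; lia.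
  (* Only k < p, b = b' + 1 and j different from 1 could remain. Then j = 0 is excluded by the rank
     of Y stacked on x1, which generically exceeds b, and j = 2 by [Y *m v], which is generically
     nonzero. *)
  exfalso; move: ss; rewrite /gen_s /=; case: ifP => kp ss; last by lia.
  case: (j) j3 ss gY gYx x1A1 => [|[|[|//]]] _ ss gY gYx x1A1.
  + have := gYx isT kp; have := Yx1 isT; lia.
  + by lia.
  + by have := gY isT ltac:(lia); rewrite Yv // eqxx.
- have aE : a = a' by move: rr; rewrite /gen_r /=; case: ifP; lia.
  have bE : b = b' by move: ss; rewrite /gen_s /=; case: ifP; lia.
  (* Type j' = 2 has x1 = 0, while x1 is generically nonzero for j <= 1. *)
  rewrite aE bE; case: (j) j3 x1 => [|[|[|//]]] _ x1 //.
  + by exfalso; apply: x1 => //; lia.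
  + by exfalso; apply: x1 => //; lia.
Qed.

End Closures.

(** * Orbits in the exotic cone *)

(* Position of L with respect to Im x12 and Ker x21, coded as in nil_pos. *)
Definition gen_pos q k a b j : nat :=
  match j with
  | 0 => (q < k)%N && (a + b == k)%N
  | 1 => 1
  | _ => if b == 0%N then 1 else 2
  end.

(** The bounds p and q come from Y X = 0 and X Y = 0, the next two from the rank condition on the
    cone; the last clause says that the j-th step of 0 ⊂ Im X ⊂ Ker Y ⊂ V1 is strict. *)
Definition nil_admissible p q k r s j : bool :=
  [&& r + s <= p, r + s <= q, r + s <= k, r + s <= p + q - k, j < 3 &
    match j with 0 => 0 < r | 1 => r + s < p | _ => 0 < s end]%N.

Lemma gen_nil_admissible p q k a b j : admissible p q k a b j ->
  nil_admissible p q k (gen_r q k a b j) (gen_s p k b j) (gen_pos q k a b j).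
Proof.
rewrite /admissible /nil_admissible /gen_r /gen_s /gen_pos.
case: j => [|[|[|j]]] /=; last by lia.
- by case: (boolP (_ && (a + b == k)%N)) => /= h; repeat (case: ifP => /= ?); lia.
- by repeat (case: ifP => /= ?); lia.
- by repeat (case: ifP => /= ?); lia.
Qed.

Lemma gen_surjective p q k r s j : (k <= p + q)%N ->
  nil_admissible p q k r s j ->
  exists a b j', [/\ admissible p q k a b j', gen_r q k a b j' = r,
    gen_s p k b j' = s & gen_pos q k a b j' = j].
Proof.
rewrite /nil_admissible /admissible /gen_r /gen_s /gen_pos.
move=> kn; pose kq := (k - q)%N; pose kp := (k - p)%N.
case: j => [|[|[|j]]] /= h; last by lia.
(* For q < k the type found has a + b < k, where [gen_r] gains a unit; hence the - 1. *)
- exists (if (k <= q)%N then r else (r + kq - 1)%N), (s + kp)%N, 0%N.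
  by rewrite /kq /kp; split=> //=; repeat (case: ifP => /= ?); lia.
(* Here q < k and r + s has its largest value, the minimum of q and p + q - k. The type chosen has a
   + b = k, so that a generic L in W∩V1 is not in Im X. *)
- have [qk|qk] := boolP [&& q < k & [|| r + s == q, r + s == k | r + s == p + q - k]]%N.
    exists (r + kq)%N, (s + kp)%N, 0%N.
    by rewrite /kq /kp; split=> //=; repeat (case: ifP => /= ?); lia.
  have [pk|pk] := leqP p k.
    exists (r + kq)%N, (s + kp)%N, 1%N.
    by rewrite /kq /kp; split=> //=; repeat (case: ifP => /= ?); lia.
  (* For k < p, type j' = 1 adds a unit to [gen_s]; s = 0 must therefore come from j' = 2 with b =
     0, where Y = 0. *)
  have [s0|s0] := posnP s.
    exists (r + kq)%N, 0%N, 2%N.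
    by rewrite /kq /kp; split=> //=; repeat (case: ifP => /= ?); lia.
  exists (r + kq)%N, (s - 1)%N, 1%N.
  by rewrite /kq /kp; split=> //=; repeat (case: ifP => /= ?); lia.
- exists (r + kq)%N, (s + kp)%N, 2%N.
  by rewrite /kq /kp; split=> //=; repeat (case: ifP => /= ?); lia.
Qed.

(* Types with the same generic orbit can differ only if one has j = 0, with
   a + b = k, and the other has j > 0. *)
Lemma gen_injective_pos p q k a b j a' b' j' :
  admissible p q k a b j -> admissible p q k a' b' j' ->
  gen_r q k a b j = gen_r q k a' b' j' -> gen_s p k b j = gen_s p k b' j' ->
  gen_pos q k a b j = gen_pos q k a' b' j' -> (j == 0)%N = (j' == 0)%N ->
  (a, b, j) = (a', b', j').
Proof.
rewrite /admissible /gen_r /gen_s /gen_pos => adm adm' er es ej ejj.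
suff [-> [-> ->]] : a = a' /\ b = b' /\ j = j' by [].
case: j j' adm adm' er es ej ejj => [|[|[|j]]] [|[|[|j']]] //=;
  try (by lia); repeat (case: ifP => /= ?); lia.
Qed.

(** The hypothesis on p is the negation of q < k < p: p > p + q - k means q < k, and q < k < p
    already implies p > q + 1. *)
Lemma gen_injective p q k a b j a' b' j' :
  (p <= maxn (maxn k (p + q - k)) (q + 1))%N ->
  admissible p q k a b j -> admissible p q k a' b' j' ->
  gen_r q k a b j = gen_r q k a' b' j' -> gen_s p k b j = gen_s p k b' j' ->
  gen_pos q k a b j = gen_pos q k a' b' j' ->
  (a, b, j) = (a', b', j').
Proof.
move=> hp adm adm' er es ej; apply: (gen_injective_pos adm adm') => //.
move: hp adm adm' er es ej; rewrite /admissible /gen_r /gen_s /gen_pos.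
case: j j' => [|[|[|j]]] [|[|[|j']]] //=;
  try (by lia); repeat (case: ifP => /= ?); lia.
Qed.

Section Orbits.
Context {R : realType} {p q : nat}.
Local Notation C := (R[i]).
Local Notation n := (p + q)%N.
Implicit Types e : PV1 R p q * 'M[C]_n.

Definition orbit_type r s j : set (PV1 R p q * 'M[C]_n) :=
  [set e | exists v X Y, [/\ <[col_mx v 0]>%VS = val e.1,
     e.2 = block_mx 0 X Y 0 & nil_type r s j X Y v]].

Lemma PV1_frame (L : PV1 R p q) :
  exists2 v : 'cV[C]_p, <[col_mx v 0]>%VS = val L & v != 0.
Proof.
case/andP: (valP L) => /eqP /vspace_frame[w [wL rw]] LV.
have : w \in V1 R p q by apply: (subvP LV); rewrite -wL -vline_imx memv_line.
rewrite memV1 => /eqP w0.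
have wE : w = col_mx (usubmx w) 0 by rewrite -[0]w0 vsubmxK.
exists (usubmx w); first by rewrite -wE vline_imx.
by apply/eqP => u0; move: rw; rewrite wE u0 col_mx0 mxrank0.
Qed.

Lemma PV1_frame_eq (L : PV1 R p q) (v w : 'cV[C]_p) :
  <[col_mx v 0]>%VS = val L -> <[col_mx w 0]>%VS = val L ->
  w != 0 -> exists2 c, c != 0 & w = c *: v.
Proof.
move=> vL wL w0; have : (col_mx w 0 : 'cV[C]_n) \in <[col_mx v 0 : 'cV[C]_n]>%VS.
  by rewrite vL -wL memv_line.
case/vlineP => c; rewrite scale_col_mx => /eq_col_mx[wE _].
by exists c => //; apply: contra w0 => /eqP c0; rewrite wE c0 scale0r.
Qed.

Lemma nil_posZ j (X : 'M[C]_(p, q)) (Y : 'M[C]_(q, p)) v c : c != 0 ->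
  nil_pos j X Y v -> nil_pos j X Y (c *: v).
Proof.
move=> c0; case: j => [[f ->]|[[Yv nv]|j Yv]] /=.
- by exists (c *: f); rewrite scalemxAr.
- split; first by rewrite -scalemxAr Yv scaler0.
  move=> [f cf]; apply: nv; exists (c^-1 *: f).
  by rewrite -scalemxAr -cf scalerA mulVf // scale1r.
- rewrite -scalemxAr => /eqP; rewrite scaler_eq0 (negPf c0) /= => /eqP.
  exact: Yv.
Qed.

Lemma nil_typeZ r s j (X : 'M[C]_(p, q)) (Y : 'M[C]_(q, p)) v c : c != 0 ->
  nil_type r s j X Y v -> nil_type r s j X Y (c *: v).
Proof.
move=> c0 [XY rX rY v0 jv]; split=> //; last exact: nil_posZ.
by rewrite scaler_eq0 negb_or c0.
Qed.

Lemma nil_type_unique r s j r' s' j' (X : 'M[C]_(p, q)) (Y : 'M[C]_(q, p)) v :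
  (j < 3)%N -> (j' < 3)%N ->
  nil_type r s j X Y v -> nil_type r' s' j' X Y v -> (r, s, j) = (r', s', j').
Proof.
move=> j3 j3' [[XY YX] <- <- _ jv] [_ <- <- _ jv']; suff -> : j = j' by [].
have YX0 : (exists f, v = X *m f) -> Y *m v = 0.
  by move=> [f ->]; rewrite mulmxA YX mul0mx.
case: j j' j3 j3' jv jv' => [|[|[|//]]] [|[|[|//]]] _ _ //=; tauto.
Qed.

Lemma orbit_type_unique r s j r' s' j' e : (j < 3)%N -> (j' < 3)%N ->
  orbit_type r s j e -> orbit_type r' s' j' e -> (r, s, j) = (r', s', j').
Proof.
move=> j3 j3' [v [X [Y [vL xE tX]]]] [v' [X' [Y' [vL' xE' tX']]]].
move: xE; rewrite xE' => /eq_block_mx[_ XX YY _]; subst X' Y'.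
have [_ _ _ v'0 _] := tX'.
have [c c0 v'E] := PV1_frame_eq vL vL' v'0.
apply: (nil_type_unique j3 j3' (nil_typeZ c0 tX)).
by rewrite -v'E.
Qed.

Lemma Korbit_orbit_type r s j e e' :
  orbit_type r s j e -> Korbit e e' -> orbit_type r s j e'.
Proof.
move=> [v [X [Y [vL xE [[XY YX] rX rY v0 jv]]]]] [g [g1 [g2 [u1 u2 gE]]]].
rewrite gE xE -vL => -[L'E x'E].
exists (g1 *m v), (g1 *m X *m invmx g2), (g2 *m Y *m invmx g1); split.
- by rewrite L'E !vline_imx img_imx mul_diag_col mulmx0.
- rewrite x'E invmx_block_diag ?block_diag_mx_unit ?u1 //.
  by rewrite mul_diag_block !(mulmx0, mul0mx).
split.
- rewrite -!mulmxA (mulKmx u1) (mulKmx u2) !(mulmxA X) !(mulmxA Y) XY YX.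
  by rewrite !mul0mx !mulmx0.
- by rewrite mxrank_unitr ?unitmx_inv // mxrank_unitl.
- by rewrite mxrank_unitr ?unitmx_inv // mxrank_unitl.
- by apply: contra v0 => /eqP gv; rewrite -(mulKmx u1 v) gv mulmx0.
- have e1 f : g1 *m v = g1 *m X *m invmx g2 *m f -> v = X *m (invmx g2 *m f).
    by rewrite -!mulmxA => /(can_inj (mulKmx u1)).
  case: j jv => [[f ->]|[[Yv nv]|j Yv]] /=.
  + by exists (g2 *m f); rewrite -!mulmxA mulKmx.
  + split; first by rewrite -!mulmxA mulKmx // Yv mulmx0.
    move=> [f /e1 vf]; by apply: nv; exists (invmx g2 *m f).
  + rewrite -!mulmxA mulKmx // => gYv; apply: Yv.
    by rewrite -(mulKmx u2 (Y *m v)) gYv mulmx0.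
Qed.

Lemma KorbitE r s j e : orbit_type r s j e -> Korbit e = orbit_type r s j.
Proof.
move=> te; rewrite eqEsubset; split=> e'; first exact: Korbit_orbit_type.
case: te => v [X [Y [vL xE tX]]] [v' [X' [Y' [vL' xE' tX']]]].
have [g1 [g2 [[u1 u2] gX gY gv]]] := nil_type_transitive tX tX'.
exists (block_mx g1 0 0 g2); first by exists g1, g2.
rewrite -vL -vL' xE xE' !vline_imx img_imx mul_diag_col mulmx0 gv; split=> //.
rewrite invmx_block_diag ?block_diag_mx_unit ?u1 // mul_diag_block.
by rewrite !(mulmx0, mul0mx) gX gY !mulmxK.
Qed.

Lemma rank_antidiag (X : 'M[C]_(p, q)) (Y : 'M[C]_(q, p)) :
  \rank (block_mx 0 X Y 0) = (\rank X + \rank Y)%N.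
Proof.
rewrite block_mxEv rank_col_mxC -block_mxEv rank_diag_block_mx addnC //.
Qed.

Lemma exotic_orbit_type k e : (k <= p + q)%N -> exotic k e ->
  exists r s j, nil_admissible p q k r s j /\ orbit_type r s j e.
Proof.
move=> kn [x0 xx rx]; have [v vL v0] := PV1_frame e.1.
pose X := ursubmx e.2; pose Y := dlsubmx e.2.
have xE : e.2 = block_mx 0 X Y 0.
  rewrite -[LHS]submxK; move: x0; rewrite /frs /= /theta => /eqP.
  by rewrite block_mx_eq0 => /and4P[/eqP-> _ _ /eqP->].
move: xx rx; rewrite xE rank_antidiag mulmx_block !mul0mx !mulmx0 !add0r !addr0.
move=> /eqP; rewrite block_mx_eq0 => /and4P[/eqP XY _ _ /eqP YX] rx.
have lep := mulmx0_rank_max YX; have leq := mulmx0_rank_max XY.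
suff [j [j3 jv]] : exists j, (j < 3)%N /\ nil_pos j X Y v.
  have tX : nil_type (\rank X) (\rank Y) j X Y v by [].
  exists (\rank X), (\rank Y), j; split; last by exists v, X, Y.
  apply/and5P; split; try lia.
  apply/andP; split=> //; case: j jv j3 {tX} => [[f vf]|[[Yv nv]|[Yv|//]]] _ /=.
  - rewrite lt0n mxrank_eq0; apply/eqP => X0.
    by case/eqP: v0; rewrite vf X0 mul0mx.
  - have /mulmx0_rank_max : Y *m row_mx X v = 0.
      by rewrite mul_mx_row YX Yv row_mx0.
    by rewrite (rank_row_mx_notin nv); lia.
  - rewrite lt0n mxrank_eq0; apply/eqP => Y0.
    by apply: Yv; rewrite Y0 mul0mx.
case: (pselect (exists f, v = X *m f)) => [|nv]; first by exists 0%N.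
case: (eqVneq (Y *m v) 0) => [Yv|/eqP Yv]; first by exists 1%N.
by exists 2%N.
Qed.

Lemma orbit_type_exotic k r s j e : (r + s <= k)%N -> (r + s <= p + q - k)%N ->
  orbit_type r s j e -> exotic k e.
Proof.
move=> rsk rsn [v [X [Y [vL xE [[XY YX] rX rY _ _]]]]].
rewrite /exotic /nilcone2 /frs /= xE; split.
- by rewrite /theta block_mxKul block_mxKdr block_mx0.
- by rewrite mulmx_block XY YX !mul0mx !mulmx0 !add0r block_mx0.
- by rewrite rank_antidiag rX rY; lia.
Qed.

Lemma exotic_orbitsP k X : (k <= p + q)%N -> exotic_orbits k X ->
  exists r s j, nil_admissible p q k r s j /\ X = orbit_type r s j.
Proof.
move=> kn [e ex <-]; have [r [s [j [adm te]]]] := exotic_orbit_type kn ex.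
by exists r, s, j; rewrite (KorbitE te).
Qed.

Lemma exotic_orbits_disjoint k X X' e : (k <= p + q)%N ->
  exotic_orbits k X -> exotic_orbits k X' -> X e -> X' e -> X = X'.
Proof.
move=> kn /(exotic_orbitsP kn)[r [s [j [adm ->]]]].
move=> /(exotic_orbitsP kn)[r' [s' [j' [adm' ->]]]] te te'.
have j3 : (j < 3)%N by case/and5P: adm => _ _ _ _ /andP[].
have j3' : (j' < 3)%N by case/and5P: adm' => _ _ _ _ /andP[].
by case: (orbit_type_unique j3 j3' te te') => -> -> ->.
Qed.

End Orbits.

(** * The generic orbit of a conormal bundle *)

Section Generic.
Context {R : realType} {p q k : nat}.
Local Notation C := (R[i]).
Local Notation n := (p + q)%N.
Local Notation GPL := (GPL R p q k).

Definition gen_orbit a b j : set (PV1 R p q * 'M[C]_n) :=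
  orbit_type (gen_r q k a b j) (gen_s p k b j) (gen_pos q k a b j).

(** The required ranks are bounded below only, which is an open condition; the matching upper bounds
    hold on the whole bundle. *)
Lemma nil_type_generic a b j (A1 : 'M[C]_(p, k)) (A2 : 'M[C]_(q, k)) v phi X Y :
  admissible p q k a b j ->
  pair_type a b j A1 A2 v -> conormal_fibre A1 A2 v phi X Y ->
  (gen_r q k a b j <= \rank X)%N -> (gen_s p k b j <= \rank Y)%N ->
  (gen_r q k a b j + (0 < gen_pos q k a b j) <= \rank (row_mx X v))%N ->
  ((1 < gen_pos q k a b j)%N <= \rank (Y *m v))%N ->
  nil_type (gen_r q k a b j) (gen_s p k b j) (gen_pos q k a b j) X Y v.
Proof.
move=> adm tA fA rX rY rXv rYv.
have {}rX : \rank X = gen_r q k a b j.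
  by apply/eqP; rewrite eqn_leq rX (rank_X_le_gen tA fA).
have {}rY : \rank Y = gen_s p k b j.
  by apply/eqP; rewrite eqn_leq rY (rank_Y_le_gen tA fA).
case: (tA) => _ _ _ v0 _; split=> //; first exact: X_Y_square0 fA.
have nX : (0 < gen_pos q k a b j)%N -> ~ (exists f, v = X *m f).
  by move=> g0 /rank_row_mxP; rewrite rX; lia.
have j3 : (j < 3)%N by case/and5P: adm.
have Yv : (gen_pos q k a b j <= 1)%N -> Y *m v = 0.
  case: (leqP j 1) => [j1 _|j1]; first exact: Yv_eq0 tA fA j1.
  have j2 : j = 2%N by lia.
  (* For j = 2 and b = 0 admissibility gives k < p, so [gen_s] is 0 and Y vanishes: L lies in Ker Y
     although it is not in W + V2. *)
  rewrite j2 /gen_pos; case: eqVneq => // b0 _.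
  have -> : Y = 0; last by rewrite mul0mx.
  apply/eqP; rewrite -mxrank_eq0 rY /gen_s j2 b0.
  by move: adm; rewrite /admissible j2 b0; case: ifP; lia.
case E : (gen_pos q k a b j) nX Yv rYv rXv => [|[|m]] nX Yv rYv rXv /=.
- apply/rank_row_mxP; rewrite rX.
  move: E; rewrite /gen_pos; case: j j3 tA {adm rX rY nX Yv rYv rXv}
    => [|[|[|//]]] _ tA //; last by case: ifP.
  (* Position 0 excludes q < k with a + b = k; otherwise one of the two bounds on the rank of
     [row_mx X v] equals [gen_r], so v adds nothing to Im X. *)
  have [h1 h2] := rank_Xv_le tA fA erefl; have abk := pair_type_leq tA.
  by rewrite /gen_r; case: ifP; lia.
- by split; [exact: Yv | exact: nX].
- by move=> Yv0; move: rYv; rewrite Yv0 mxrank0.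
Qed.

Lemma generic_rank_conditions a b j (A1 : 'M[C]_(p, k)) (A2 : 'M[C]_(q, k)) v phi X Y :
  pair_type a b j A1 A2 v -> conormal_fibre A1 A2 v phi X Y ->
  generic_fibre a b j A1 v phi X Y ->
  (gen_r q k a b j + (0 < gen_pos q k a b j) <= \rank (row_mx X v))%N /\
  ((1 < gen_pos q k a b j)%N <= \rank (Y *m v))%N.
Proof.
move=> tA fA [rX rY gX gY _]; split; last first.
  case: (leqP (gen_pos q k a b j) 1) => // g1.
  rewrite lt0n mxrank_eq0; apply: gY.
    by move: g1; rewrite /gen_pos; case: j {tA fA rX rY gX} => [|[|j]] //; lia.
  by rewrite lt0n; apply/eqP => b0; move: g1; rewrite /gen_pos b0; case: (j) => [|[|]] //=; lia.
rewrite -rX; case: (posnP (gen_pos q k a b j)) => [_|g0].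
  by rewrite addn0 leq_rank_row_mx.
rewrite rank_row_mx_notin ?addn1 //.
case: (posnP j) => [j0|]; last exact: notin_im_X tA fA.
move: g0; rewrite /gen_pos j0 lt0b => /andP[qk /eqP ab].
exact: gX.
Qed.

Lemma gen_orbit_open a b j : admissible p q k a b j ->
  exists U : set GPL, [/\ open U, (exists t, U t /\ stratum a b j t) &
    forall t, U t -> stratum a b j t -> gen_orbit a b j (pi_map t)].
Proof.
move=> adm.
pose U : set GPL :=
  ~` (rank_below (cov_X p q k) (gen_r q k a b j) `|`
      rank_below (cov_Y p q k) (gen_s p k b j) `|`
      rank_below (cov_Xv p q k) (gen_r q k a b j + (0 < gen_pos q k a b j)) `|`
      rank_below (cov_Yv p q k) (1 < gen_pos q k a b j)).
have UE t (A1 : 'M[C]_(p, k)) (A2 : 'M[C]_(q, k)) v phi X Y :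
    frame (col_mx A1 A2) (col_mx v 0) t -> endx t = block_mx (v *m phi) X Y 0 ->
    U t <-> [/\ (gen_r q k a b j <= \rank X)%N, (gen_s p k b j <= \rank Y)%N,
      (gen_r q k a b j + (0 < gen_pos q k a b j) <= \rank (row_mx X v))%N &
      ((1 < gen_pos q k a b j)%N <= \rank (Y *m v))%N].
  move=> fr xE; rewrite /U !setCU /setC /setI /=.
  rewrite (rank_belowE (cov_X p q k) _ fr) (rank_belowE (cov_Y p q k) _ fr).
  rewrite (rank_belowE (cov_Xv p q k) _ fr) (rank_belowE (cov_Yv p q k) _ fr).
  rewrite /= xE block_mxKur block_mxKdl col_mxKu.
  split=> [[[[/negP h1 /negP h2] /negP h3] /negP h4]|[h1 h2 h3 h4]].
    by split; rewrite leqNgt.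
  by (split; [split; [split|]|]); apply/negP; rewrite -leqNgt.
exists U; split.
- by apply: closed_openC; do !apply: closedU; exact: rank_below_closed.
- have [A1 [A2 [v [phi [X [Y [tA fA gA]]]]]]] := @generic_exists C _ _ _ _ _ _ adm.
  have [|t [st fr tx]] := stratum_build tA (x := block_mx (v *m phi) X Y 0).
    by exists phi, X, Y.
  exists t; split=> //; apply/(UE _ _ _ _ _ _ _ fr tx).
  have [h3 h4] := generic_rank_conditions tA fA gA.
  by case: gA => -> -> _ _ _; split.
- move=> t Ut [A1 [A2 [v [fr tA [phi [X [Y [xE fA]]]]]]]].
  have [h1 h2 h3 h4] := (UE _ _ _ _ _ _ _ fr xE).1 Ut.
  exists v, X, Y; split; first by case: fr.
    by rewrite /= xE /mtheta block_mxKur block_mxKdl.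
  exact: nil_type_generic fA _ _ _ _.
Qed.

Lemma gen_orbit_exotic a b j : admissible p q k a b j ->
  exotic_orbits k (gen_orbit a b j).
Proof.
move=> adm; have [U [_ [t [Ut st]] UO]] := gen_orbit_open adm.
have tt := UO t Ut st; exists (pi_map t); last exact: KorbitE.
have /and5P[_ _ rk rn _] := gen_nil_admissible adm.
exact: orbit_type_exotic rk rn tt.
Qed.

End Generic.

(** * The map Xi *)

Section Parametrization.
Context {R : realType} {p q k : nat}.
Local Notation C := (R[i]).
Local Notation GPL := (GPL R p q k).
Local Notation type := (nat * nat * nat)%type.
Implicit Types i : type.

Definition type_admissible i := admissible p q k i.1.1 i.1.2 i.2.
Definition types : seq type :=
  [seq i <- [seq (ab, j) | ab <- [seq (a, b) | a <- iota 0 k.+1, b <- iota 0 k.+1],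
                           j <- iota 0 3] | type_admissible i].
Definition type_stratum i : set GPL := stratum i.1.1 i.1.2 i.2.
Definition type_component i : set GPL := component type_stratum (conormal k) i.
Definition type_orbit i : set (PV1 R p q * 'M[C]_(p + q)) :=
  gen_orbit (k := k) i.1.1 i.1.2 i.2.

Lemma mem_types i : (i \in types) = type_admissible i.
Proof.
rewrite mem_filter; apply: andb_idr; case: i => [[a b] j].
case/and5P => abk _ _ j3 _; apply: allpairs_f; last by rewrite mem_iota.
by apply: allpairs_f; rewrite mem_iota /= ltnS; move: abk => /=; lia.
Qed.

Lemma conormal_types t :
  conormal k t <-> exists2 i, i \in types & type_stratum i t.
Proof.
split=> [/conormal_stratum[a [b [j [adm st]]]]|[i _ /stratum_conormal//]].
by exists (a, b, j); rewrite ?mem_types.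
Qed.

Lemma type_stratum_irreducible i : i \in types -> irreducible (type_stratum i).
Proof. by rewrite mem_types => /stratum_irreducible. Qed.

Lemma type_stratum_incl i i' : i \in types -> i' \in types ->
  type_stratum i `<=` closure (type_stratum i') -> i = i'.
Proof.
rewrite !mem_types; case: i i' => [[a b] j] [[a' b'] j'].
exact: stratum_incl.
Qed.

Lemma type_orbit_exotic i : i \in types -> exotic_orbits k (type_orbit i).
Proof. by rewrite mem_types; exact: gen_orbit_exotic. Qed.

Lemma type_orbit_open i : i \in types -> exists U : set GPL, [/\ open U,
  (exists t, U t /\ type_stratum i t) &
  forall t, U t -> type_stratum i t -> type_orbit i (pi_map t)].
Proof. by rewrite mem_types; exact: gen_orbit_open. Qed.

Lemma Irr_types D : Irr (conormal k) D <->
  exists2 i, i \in types & D = type_component i.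
Proof.
exact: (Irr_component conormal_types type_stratum_irreducible type_stratum_incl).
Qed.

Lemma component_sub_type_orbit i : i \in types ->
  type_component i `<=` closure_preim k (type_orbit i).
Proof.
move=> it; exact: (component_sub_closure conormal_types
  type_stratum_irreducible type_orbit_open it).
Qed.

Hypothesis kn : (k <= p + q)%N.

Lemma component_type_orbit_unique i X : i \in types -> exotic_orbits k X ->
  type_component i `<=` closure_preim k X -> X = type_orbit i.
Proof.
move=> it OX iX.
apply: (component_orbit_unique conormal_types type_stratum_irreducible
  type_stratum_incl _ type_orbit_exotic type_orbit_open it OX iX).
by move=> Z Z' e OZ OZ'; exact: (exotic_orbits_disjoint kn OZ OZ').
Qed.

Lemma Xi_type i : i \in types -> Xi (type_component i) = type_orbit i.
Proof.
move=> it; apply: xget_unique.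
  by split; [exact: type_orbit_exotic | exact: component_sub_type_orbit].
by move=> X [OX iX]; exact: component_type_orbit_unique.
Qed.

Lemma type_orbit_eq i i' : i \in types -> i' \in types ->
  type_orbit i = type_orbit i' ->
  [/\ gen_r q k i.1.1 i.1.2 i.2 = gen_r q k i'.1.1 i'.1.2 i'.2,
      gen_s p k i.1.2 i.2 = gen_s p k i'.1.2 i'.2 &
      gen_pos q k i.1.1 i.1.2 i.2 = gen_pos q k i'.1.1 i'.1.2 i'.2].
Proof.
move=> it it' ii'; have [U [_ [t [Ut st]] UO]] := type_orbit_open it.
have tt := UO t Ut st; have tt' := tt; rewrite ii' in tt'.
have j3 i0 : i0 \in types -> (gen_pos q k i0.1.1 i0.1.2 i0.2 < 3)%N.
  by rewrite mem_types => /gen_nil_admissible/and5P[_ _ _ _ /andP[]].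
by case: (orbit_type_unique (j3 _ it) (j3 _ it') tt tt') => -> -> ->.
Qed.

Lemma type_orbit_surjective X : exotic_orbits k X ->
  exists2 i, i \in types & type_orbit i = X.
Proof.
move=> /(exotic_orbitsP kn)[r [s [j [adm ->]]]].
have [a [b [j' [adm' <- <- <-]]]] := gen_surjective kn adm.
by exists (a, b, j'); rewrite ?mem_types.
Qed.

Lemma type_orbit_inj_pos i i' : i \in types -> i' \in types ->
  type_orbit i = type_orbit i' -> (i.2 == 0)%N = (i'.2 == 0)%N -> i = i'.
Proof.
move=> it it' /(type_orbit_eq it it').
move: i i' it it' => [[a b] j] [[a' b'] j']; rewrite !mem_types => adm adm'.
by case=> er es ej jj; exact: (gen_injective_pos adm adm' er es ej jj).
Qed.

Lemma type_orbit_inj i i' : (p <= maxn (maxn k (p + q - k)) (q + 1))%N ->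
  i \in types -> i' \in types -> type_orbit i = type_orbit i' -> i = i'.
Proof.
move=> hp it it' /(type_orbit_eq it it').
move: i i' it it' => [[a b] j] [[a' b'] j']; rewrite !mem_types => adm adm'.
by case=> er es ej; exact: (gen_injective hp adm adm' er es ej).
Qed.

(** The fibre is covered by the image of {0, 1}: one bit tells whether j = 0, and by
    [type_orbit_inj_pos] this bit and the orbit determine the type. *)
Lemma Xi_fibre_card X :
  (Irr (conormal k) `&` @Xi R p q k @^-1` [set X] #<= `I_2)%card.
Proof.
pose P m : set (set GPL) := [set D | exists2 i, i \in types &
  [/\ D = type_component i, type_orbit i = X & (i.2 == 0)%N = (m == 0)%N]].
apply: card_le_trans (card_image_le (fun m => xget set0 (P m)) _).
apply: subset_card_le => D [/Irr_types[i it ->]].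
rewrite /= Xi_type // => iX; exists (i.2 != 0)%N; first by case: eqP.
apply: xget_unique; first by exists i => //; split=> //; case: eqP.
move=> D' [i' it' [-> i'X ii']]; congr type_component.
apply: type_orbit_inj_pos => //; first by rewrite i'X.
by rewrite ii'; case: (i.2 == 0)%N.
Qed.

End Parametrization.

Theorem theorem1p7 (R : realType) (p q k : nat)
    (hn : (1 <= p + q)%N) (hk : (k <= p + q)%N) :
  [/\ (forall D : set (GPL R p q k), Irr (conormal k) D ->
         exists! O : set (PV1 R p q * 'M[R[i]%C]_(p + q)),
           exotic_orbits k O /\ (D `<=` closure_preim k O)%classic),
      set_fun (Irr (conormal k)) (exotic_orbits k) (@Xi R p q k),
      set_surj (Irr (conormal k)) (exotic_orbits k) (@Xi R p q k),
      (forall O : set (PV1 R p q * 'M[R[i]%C]_(p + q)), exotic_orbits k O ->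
         (Irr (conormal k) `&` @Xi R p q k @^-1` [set O] #<= `I_2)%classic%card) &
      ((p <= maxn (maxn k (p + q - k)) (q + 1))%N ->
         set_bij (Irr (conormal k)) (exotic_orbits k) (@Xi R p q k))].
Proof.
have Xi_fun : set_fun (Irr (conormal k)) (exotic_orbits k) (@Xi R p q k).
  by move=> _ /Irr_types[i it ->]; rewrite Xi_type //; exact: type_orbit_exotic.
have Xi_surj : set_surj (Irr (conormal k)) (exotic_orbits k) (@Xi R p q k).
  move=> X /(type_orbit_surjective hk)[i it iX]; exists (type_component i).
    by apply/Irr_types; exists i.
  by rewrite Xi_type.
split=> //.
- move=> _ /Irr_types[i it ->]; exists (@type_orbit R p q k i); split.
    by split; [exact: type_orbit_exotic | exact: component_sub_type_orbit].
  move=> X [OX iX]; apply/esym; exact: component_type_orbit_unique.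
- by move=> X _; exact: Xi_fibre_card.
- move=> hp; split=> // D D'; rewrite !inE.
  move=> /Irr_types[i it ->] /Irr_types[i' it' ->]; rewrite !Xi_type // => ii'.
  by congr type_component; exact: type_orbit_inj ii'.
Qed.
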